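(* Let $H \in K[x]^m$ be a quadratic homogeneous polynomial map such that $\mathrm{rk}\, \mathcal{J} H = 3$. Then there exist $S \in \mathrm{GL}_m(K)$ and $T \in \mathrm{GL}_n(K)$ such that for $\tilde{H} := S\, H(Tx)$ one of the following statements holds: (1) Only the first $3$ rows of $\mathcal{J} \tilde{H}$ may be nonzero; (2) Only the first $4$ rows of $\mathcal{J} \tilde{H}$ may be nonzero, and $$(\tilde{H}_1,\tilde{H}_2,\tilde{H}_3,\tilde{H}_4) = (\tilde{H}_1, \tfrac12 x_1^2, x_1 x_2, \tfrac12 x_2^2)$$ (in particular, $\mathrm{char}\, K \ne 2$); (3) Only the first $4$ rows of $\mathcal{J} \tilde{H}$ may be nonzero, $$\mathcal{J} (\tilde{H}_1,\tilde{H}_2,\tilde{H}_3,\tilde{H}_4) = \mathcal{J} (\tilde{H}_1, x_1 x_2, x_1 x_3, x_2 x_3)$$ and $\mathrm{char}\, K = 2$; (4) Either $\mathrm{char}\, K \neq 2$ and only the first $3$ columns of $\mathcal{J}\tilde{H}$ are nonzero, or $\mathrm{char}\, K = 2$ and only the first $4$ columns of $\mathcal{J}\tilde{H}$ are nonzero; (5) Only the first $4$ rows of $\mathcal{J} \tilde{H}$ may be nonzero, and $$(\tilde{H}_1,\tilde{H}_2,\tilde{H}_3,\tilde{H}_4) = \big( x_1 x_3 + c x_2 x_4,\; x_2 x_3 - x_1 x_4,\; \tfrac12 x_3^2 + \tfrac{c}{2} x_4^2,\; \tfrac12 x_1^2 + \tfrac{c}{2} x_2^2 \big)$$ for some nonzero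 $c \in K$ (in particular, $\mathrm{char}\, K \ne 2$). Conversely, for every quadratic homogeneous $\tilde{H} \in K[x]^m$ that satisfies one of the five statements above, $\mathrm{rk}\, \mathcal{J} \tilde{H} \le 3$.
   Context: $K$ is an arbitrary field, $m,n$ are positive integers, $x=(x_1,\ldots,x_n)$ is a tuple of variables, and $K[x]=K[x_1,\ldots,x_n]$. A map $H=(H_1,\ldots,H_m)\in K[x]^m$ is quadratic homogeneous if every component is zero or homogeneous of degree $2$. $\mathcal{J}H = (\partial H_i/\partial x_j)_{i,j}$ is the $m\times n$ Jacobian matrix with respect to $x$, and $\mathrm{rk}$ denotes rank over the field $K(x)$. $H(Tx)$ is the composition of $H$ with the linear map given by $T$. ''Only the first $k$ rows (columns) are / may be nonzero'' means that all rows (columns) with index larger than $k$ are zero. *)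

(* Defs.v *)
From HB Require Import structures.
From mathcomp Require Import all_boot all_algebra.
From mathcomp Require Import mpoly.

Set Implicit Arguments.
Unset Strict Implicit.
Unset Printing Implicit Defensive.

Import GRing.Theory.
Local Open Scope ring_scope.

(* A polynomial map in K[x_1, .., x_n]^m is a column vector of polynomials;
   x_(i+1) is ['X_i] with [i : 'I_n]. *)
Definition polymap (K : fieldType) (m n : nat) := 'cV[{mpoly K[n]}]_m.

(* [0 \is 2.-homog] holds, so zero components are allowed. *)
Definition quadratic_homogeneous (K : fieldType) (m n : nat)
    (H : polymap K m n) : Prop :=
  forall i : 'I_m, H i 0 \is 2.-homog.

Definition jacobian (K : fieldType) (m n : nat) (H : polymap K m n) :
    'M[{mpoly K[n]}]_(m, n) :=
  \matrix_(i < m, j < n) (H i 0)^`M(j).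

(* The rank over K(x) = Frac K[x]. *)
Definition rk (K : fieldType) (m n p : nat) (A : 'M[{mpoly K[n]}]_(m, p)) :
    nat :=
  \rank (map_mx (@tofrac {mpoly K[n]}) A).

(* H(Tx): substitute (Tx)_i = \sum_j T_ij x_j for x_i. *)
Definition comp_linear (K : fieldType) (m n : nat) (H : polymap K m n)
    (T : 'M[K]_n) : polymap K m n :=
  map_mx (comp_mpoly [tuple \sum_(j < n) T i j *: 'X_j | i < n]) H.

(* S H, with S acting through the constants K -> K[x]. *)
Definition lmul_const (K : fieldType) (m n : nat) (S : 'M[K]_m)
    (H : polymap K m n) : polymap K m n :=
  map_mx (@mpolyC n K) S *m H.

Definition only_first_rows (R : nmodType) (m n k : nat) (A : 'M[R]_(m, n)) :
    Prop :=
  forall i : 'I_m, (k <= i)%N -> row i A = 0.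

Definition only_first_cols (R : nmodType) (m n k : nat) (A : 'M[R]_(m, n)) :
    Prop :=
  forall j : 'I_n, (k <= j)%N -> col j A = 0.

Definition first_components (K : fieldType) (m n k : nat) (hk : (k <= m)%N)
    (H : polymap K m n) : polymap K k n :=
  rowsub (widen_ord hk) H.

Definition polymap4 (K : fieldType) (n : nat) (a b c d : {mpoly K[n]}) :
    polymap K 4%N n :=
  \col_(i < 4) tnth [tuple a; b; c; d] i.

(* The variable x_(i+1) for i < k, where k <= n. *)
Definition var (K : fieldType) (n k : nat) (hk : (k <= n)%N) (i : 'I_k) :
    {mpoly K[n]} :=
  'X_(widen_ord hk i).

(* Naming the components Ht_1, .., Ht_4 presupposes 4 <= m, naming x_1, .., x_k
   presupposes k <= n, and writing 1/2 presupposes char K <> 2 (in MathComp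
   2^-1 is 0 in characteristic 2): these are made explicit below. *)

Definition form1 (K : fieldType) (m n : nat) (Ht : polymap K m n) : Prop :=
  only_first_rows 3%N (jacobian Ht).

Definition form2 (K : fieldType) (m n : nat) (Ht : polymap K m n) : Prop :=
  2%N \notin [pchar K] /\
  exists (hm : (4 <= m)%N) (hn : (2 <= n)%N),
    let x1 := var K hn (inord 0%N) in
    let x2 := var K hn (inord 1%N) in
    only_first_rows 4%N (jacobian Ht) /\
    first_components hm Ht =
      polymap4 (first_components hm Ht 0 0)
               (2^-1 *: x1 ^+ 2) (x1 * x2) (2^-1 *: x2 ^+ 2).

Definition form3 (K : fieldType) (m n : nat) (Ht : polymap K m n) : Prop :=
  2%N \in [pchar K] /\
  exists (hm : (4 <= m)%N) (hn : (3 <= n)%N),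
    let x1 := var K hn (inord 0%N) in
    let x2 := var K hn (inord 1%N) in
    let x3 := var K hn (inord 2%N) in
    only_first_rows 4%N (jacobian Ht) /\
    jacobian (first_components hm Ht) =
      jacobian (polymap4 (first_components hm Ht 0 0)
                         (x1 * x2) (x1 * x3) (x2 * x3)).

Definition form4 (K : fieldType) (m n : nat) (Ht : polymap K m n) : Prop :=
  (2%N \notin [pchar K] /\ only_first_cols 3%N (jacobian Ht)) \/
  (2%N \in [pchar K] /\ only_first_cols 4%N (jacobian Ht)).

Definition form5 (K : fieldType) (m n : nat) (Ht : polymap K m n) : Prop :=
  2%N \notin [pchar K] /\
  exists (hm : (4 <= m)%N) (hn : (4 <= n)%N) (c : K),
    let x1 := var K hn (inord 0%N) in
    let x2 := var K hn (inord 1%N) in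
    let x3 := var K hn (inord 2%N) in
    let x4 := var K hn (inord 3%N) in
    c != 0 /\
    only_first_rows 4%N (jacobian Ht) /\
    first_components hm Ht =
      polymap4 (x1 * x3 + c *: (x2 * x4))
               (x2 * x3 - x1 * x4)
               (2^-1 *: x3 ^+ 2 + (c / 2) *: x4 ^+ 2)
               (2^-1 *: x1 ^+ 2 + (c / 2) *: x2 ^+ 2).

Definition normal_form (K : fieldType) (m n : nat) (Ht : polymap K m n) :
    Prop :=
  form1 Ht \/ form2 Ht \/ form3 Ht \/ form4 Ht \/ form5 Ht.

(* Main.v *)
Require Import Defs.
From HB Require Import structures.
From mathcomp Require Import all_boot all_algebra.
From mathcomp Require Import mpoly ring zify.
From Stdlib Require Import Classical_Prop Classical_Pred_Type.

Set Implicit Arguments.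
Unset Strict Implicit.
Unset Printing Implicit Defensive.

Import GRing.Theory.
Local Open Scope ring_scope.

(** Write H(x) = (x A_i x^T)_i and Q_i = A_i + A_i^T, and let beta be the bilinear
    map with components Q_i, so that the Jacobian of H at x is the matrix of
    beta(x, -).  Where the normal forms prescribe the quadratic components
    themselves, 2 is invertible and H is recovered from beta; so the statement is
    about beta alone.  It is studied as a net: a linear family B h of symmetric
    (in characteristic 2: alternating) bilinear forms, h running through the linear
    forms on the target.

    The classification is first done over L = K(t), where there is a point e at
    which the Jacobian attains its generic rank 3 ([generic_point]).  Split the
    source along the kernel and the target along the image of beta(e, -), so that
    the first coordinates identify with each other: this puts the matrix of
    beta(e + t y, -) in the shape (1 + t A, t b; t c, t d).  Its 4 x 4 minors
    vanish for all t, and their coefficients give d = 0, c b = 0, c A b = 0 and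
    c A^2 b = 0, for every y ([frame_relations]).  Evaluated at well chosen y, these
    relations leave few possibilities ([odd_classification], [even_classification]):
    - beta takes its values in a space of dimension 3 ([form1]);
    - the radical of beta has codimension at most 3, or 4 in characteristic 2
      ([form4]);
    - modulo a line of the target, beta factors through a quotient of the source of
      dimension 2 ([form2]), or 3 in characteristic 2 ([form3]);
    - 2 is invertible, the radical has codimension at most 4, and there is an
      operator J with beta(J x, y) + beta(x, J y) = 0 and J^2 = - c <> 0 modulo the
      radical.  Then J makes the source modulo its radical a plane over K[J], beta
      is the map (v, w) |-> v w^* + w v^* into hermitian 2 x 2 matrices, and
      H parametrises the cone H1^2 + c H2^2 = 4 H3 H4 of singular ones ([form5]).

    The first two possibilities are rank conditions on matrices over K, hence
    descend from L to K.  A line over K(t) is spanned by a polynomial vector that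
    does not vanish at t = 0, and its value at 0 spans a line over K that works as
    well ([pencil_descent]).  The coefficients of a polynomial skew operator are
    skew operators over K; skew operators being unique up to a scalar modulo the
    radical ([skew_unique]), a coefficient that acts nontrivially still has a scalar
    square ([twisted_descent]).  The normal forms then result from a choice of bases
    over K ([coordinates_of_table]).

    Conversely, in the forms with a prescribed triple or quadruple of components the
    Jacobian has an explicit syzygy between its first four rows, and in characteristic
    2 a map in four variables has the syzygy J x = 2 H = 0 between its columns
    ([normal_form_rank]). *)

(** * Determinants of order four *)

Definition det3 (L : comNzRingType) (a b c d e f g h i : L) : L :=
  a * (e * i - f * h) - b * (d * i - f * g) + c * (d * h - e * g).

Lemma det_first_row (L : comNzRingType) n (F : nat -> nat -> L) :
  \det (\matrix_(i < n.+1, j < n.+1) F i j) =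
  \sum_(j < n.+1) F 0%N j *
     ((-1) ^+ j * \det (\matrix_(i < n, k < n) F i.+1 (bump j k))).
Proof.
rewrite (expand_det_row _ ord0); apply: eq_bigr => j _.
rewrite !mxE /cofactor add0n; congr (_ * (_ * \det _)).
by apply/matrixP => i k; rewrite !mxE.
Qed.

Lemma det_mx44 (L : comNzRingType) (F : nat -> nat -> L) :
  \det (\matrix_(i < 4, j < 4) F i j) =
    F 0%N 0%N * det3 (F 1%N 1%N) (F 1%N 2%N) (F 1%N 3%N) (F 2%N 1%N)
      (F 2%N 2%N) (F 2%N 3%N) (F 3%N 1%N) (F 3%N 2%N) (F 3%N 3%N)
  - F 0%N 1%N * det3 (F 1%N 0%N) (F 1%N 2%N) (F 1%N 3%N) (F 2%N 0%N)
      (F 2%N 2%N) (F 2%N 3%N) (F 3%N 0%N) (F 3%N 2%N) (F 3%N 3%N)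
  + F 0%N 2%N * det3 (F 1%N 0%N) (F 1%N 1%N) (F 1%N 3%N) (F 2%N 0%N)
      (F 2%N 1%N) (F 2%N 3%N) (F 3%N 0%N) (F 3%N 1%N) (F 3%N 3%N)
  - F 0%N 3%N * det3 (F 1%N 0%N) (F 1%N 1%N) (F 1%N 2%N) (F 2%N 0%N)
      (F 2%N 1%N) (F 2%N 2%N) (F 3%N 0%N) (F 3%N 1%N) (F 3%N 2%N).
Proof.
have det3E (G : nat -> nat -> L) : \det (\matrix_(i < 3, j < 3) G i j) = det3 (G 0%N 0%N) (G 0%N 1%N)
    (G 0%N 2%N) (G 1%N 0%N) (G 1%N 1%N) (G 1%N 2%N) (G 2%N 0%N) (G 2%N 1%N)
    (G 2%N 2%N) :> L.
  have det2E (H : nat -> nat -> L) : \det (\matrix_(i < 2, j < 2) H i j) =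
      H 0%N 0%N * H 1%N 1%N - H 0%N 1%N * H 1%N 0%N :> L.
    rewrite det_first_row !big_ord_recl big_ord0 /= !det_mx11 !mxE /bump /=.
    by rewrite /= expr0 expr1; ring.
  rewrite det_first_row !big_ord_recl big_ord0 /=.
  rewrite (det2E (fun i k => G i.+1 (bump 0 k))) (det2E (fun i k => G i.+1 (bump _ k))).
  rewrite (det2E (fun i k => G i.+1 (bump _ k))) /bump /= /det3.
  ring.
rewrite det_first_row !big_ord_recl big_ord0 /=.
rewrite (det3E (fun i k => F i.+1 (bump 0 k))).
do 3! rewrite (det3E (fun i k => F i.+1 (bump _ k))).
rewrite /bump /=.
rewrite /= !exprS expr0; ring.
Qed.

(** * Nets of symmetric bilinear forms *)

Record is_net (L : fieldType) (D V : lmodType L) (B : D -> V -> V -> L) : Prop := {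
  net_sym : forall h x y, B h x y = B h y x;
  net_addh : forall h h' x y, B (h + h') x y = B h x y + B h' x y;
  net_scaleh : forall c h x y, B (c *: h) x y = c * B h x y;
  net_addl : forall h x x' y, B h (x + x') y = B h x y + B h x' y;
  net_scalel : forall c h x y, B h (c *: x) y = c * B h x y
}.

Definition infinite_field (L : fieldType) :=
  forall p : {poly L}, (forall t, p.[t] = 0) -> p = 0.

Section Net.
Variables (L : fieldType) (D V : lmodType L) (B : D -> V -> V -> L).
Hypothesis netB : is_net B.

Lemma net_addr h x y y' : B h x (y + y') = B h x y + B h x y'.
Proof. by rewrite net_sym // net_addl // !(net_sym netB _ x). Qed.

Lemma net_scaler c h x y : B h x (c *: y) = c * B h x y.
Proof. by rewrite net_sym // net_scalel // !(net_sym netB _ x). Qed.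

Lemma net_opph h x y : B (- h) x y = - B h x y.
Proof. by rewrite -scaleN1r net_scaleh // mulN1r. Qed.

Lemma net_oppl h x y : B h (- x) y = - B h x y.
Proof. by rewrite -scaleN1r net_scalel // mulN1r. Qed.

Lemma net_oppr h x y : B h x (- y) = - B h x y.
Proof. by rewrite -scaleN1r net_scaler // mulN1r. Qed.

Lemma net_0h x y : B 0 x y = 0.
Proof. by rewrite -(scale0r 0) net_scaleh // mul0r. Qed.

Lemma net_0l h y : B h 0 y = 0.
Proof. by rewrite -(scale0r 0) net_scalel // mul0r. Qed.

Lemma net_0r h y : B h y 0 = 0.
Proof. by rewrite -(scale0r 0) net_scaler // mul0r. Qed.

Definition netE := (net_addh netB, net_scaleh netB, net_addl netB,
  net_scalel netB, net_addr, net_scaler, net_opph, net_oppl, net_oppr,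
  net_0h, net_0l, net_0r).

(** The functions h and v are used on indices below 4; taking them on all of nat
    lets [det_mx44] expand the determinant. *)
Definition bounded_rank3 := forall y (h : nat -> D) (v : nat -> V),
  \det (\matrix_(i < 4, j < 4) B (h i) y (v j)) = 0.

(** Dual bases of the image and a complement of the kernel of beta(e, -), whose
    rank is then exactly 3. *)
Record frame (e v1 v2 v3 : V) (h1 h2 h3 : D) : Prop := {
  fr11 : B h1 e v1 = 1; fr12 : B h1 e v2 = 0; fr13 : B h1 e v3 = 0;
  fr21 : B h2 e v1 = 0; fr22 : B h2 e v2 = 1; fr23 : B h2 e v3 = 0;
  fr31 : B h3 e v1 = 0; fr32 : B h3 e v2 = 0; fr33 : B h3 e v3 = 1
}.

Hypotheses (Linf : infinite_field L) (rank3 : bounded_rank3).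

Lemma poly4_eq0 (c0 c1 c2 c3 c4 : L) :
  (forall t, c0 + c1 * t + c2 * t ^+ 2 + c3 * t ^+ 3 + c4 * t ^+ 4 = 0) ->
  [/\ c0 = 0, c1 = 0, c2 = 0, c3 = 0 & c4 = 0].
Proof.
move=> E; have P0 : \poly_(i < 5) nth 0 [:: c0; c1; c2; c3; c4] i = 0.
  apply: Linf => t; rewrite horner_poly !big_ord_recl big_ord0 /=.
  by rewrite -[RHS](E t) /bump /= expr0; ring.
have C i : (i < 5)%N -> nth 0 [:: c0; c1; c2; c3; c4] i = 0.
  by move=> i5; have := coef0 L i; rewrite -P0 coef_poly i5.
by split; [apply: (C 0%N)|apply: (C 1%N)|apply: (C 2%N)|apply: (C 3%N)|apply: (C 4%N)].
Qed.

Section Frame.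
Variables (e v1 v2 v3 : V) (h1 h2 h3 : D).
Hypothesis F : frame e v1 v2 v3 h1 h2 h3.

(** The bordered minor on v1, v2, v3, v and h1, h2, h3, h at e itself has the
    identity as its upper left block. *)
Lemma frame_sum h v : B h e v =
  B h e v1 * B h1 e v + B h e v2 * B h2 e v + B h e v3 * B h3 e v.
Proof.
have := rank3 e (nth h [:: h1; h2; h3]) (nth v [:: v1; v2; v3]).
rewrite (det_mx44 (fun i j => B (nth h [:: h1; h2; h3] i) e
                              (nth v [:: v1; v2; v3] j))) /= /det3.
case: F => -> -> -> -> -> -> -> -> -> E.
apply/eqP; rewrite -subr_eq0; apply/eqP.
by rewrite -[RHS]E; ring.
Qed.

(** Under [frame] and [bounded_rank3] these three equations say that beta(e, u) = 0,
    respectively that h vanishes on the image of beta(e, -). *)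
Definition in_ker u := [/\ B h1 e u = 0, B h2 e u = 0 & B h3 e u = 0].
Definition in_coker h := [/\ B h e v1 = 0, B h e v2 = 0 & B h e v3 = 0].

(** The rank of beta is at most 3 along the whole line e + t y.  In the frame its
    matrix is (1 + t A, t b; t c, t d), with determinant
    t d det(1 + t A) - t^2 c adj(1 + t A) b; the coefficients of t, .., t^4 give
    d = 0, c b = 0, c A b = 0 and, by Cayley-Hamilton, c A^2 b = 0. *)
Lemma frame_relations h u y : in_coker h -> in_ker u ->
  let c1 := B h y v1 in let c2 := B h y v2 in let c3 := B h y v3 in
  let A1 x1 x2 x3 := B h1 y v1 * x1 + B h1 y v2 * x2 + B h1 y v3 * x3 in
  let A2 x1 x2 x3 := B h2 y v1 * x1 + B h2 y v2 * x2 + B h2 y v3 * x3 in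
  let A3 x1 x2 x3 := B h3 y v1 * x1 + B h3 y v2 * x2 + B h3 y v3 * x3 in
  let b1 := B h1 y u in let b2 := B h2 y u in let b3 := B h3 y u in
  let d1 := A1 b1 b2 b3 in let d2 := A2 b1 b2 b3 in let d3 := A3 b1 b2 b3 in
  [/\ B h y u = 0, c1 * b1 + c2 * b2 + c3 * b3 = 0,
      c1 * d1 + c2 * d2 + c3 * d3 = 0 &
      c1 * A1 d1 d2 d3 + c2 * A2 d1 d2 d3 + c3 * A3 d1 d2 d3 = 0].
Proof.
case=> k1 k2 k3 [w1 w2 w3].
have k4 : B h e u = 0 by rewrite frame_sum k1 k2 k3 !mul0r !addr0.
pose D4 t := fun i j => B (nth h [:: h1; h2; h3] i) (e + t *: y)
                         (nth u [:: v1; v2; v3] j).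
have E t : \det (\matrix_(i < 4, j < 4) D4 t i j) = 0 by apply: rank3.
move=> c1 c2 c3 A1 A2 A3 b1 b2 b3 d1 d2 d3.
pose a11 := B h1 y v1; pose a12 := B h1 y v2; pose a13 := B h1 y v3.
pose a21 := B h2 y v1; pose a22 := B h2 y v2; pose a23 := B h2 y v3.
pose a31 := B h3 y v1; pose a32 := B h3 y v2; pose a33 := B h3 y v3.
pose d := B h y u; pose tr := a11 + a22 + a33.
pose e2 := a11 * a22 - a12 * a21 + (a11 * a33 - a13 * a31)
  + (a22 * a33 - a23 * a32).
pose cb := c1 * b1 + c2 * b2 + c3 * b3.
pose cAb := c1 * d1 + c2 * d2 + c3 * d3.
pose cAAb := c1 * A1 d1 d2 d3 + c2 * A2 d1 d2 d3 + c3 * A3 d1 d2 d3.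
have {E} /poly4_eq0 [_] : forall t, 0 + d * t + (d * tr - cb) * t ^+ 2
     + (d * e2 - (tr * cb - cAb)) * t ^+ 3
     + (d * det3 a11 a12 a13 a21 a22 a23 a31 a32 a33
        - (cAAb - tr * cAb + e2 * cb)) * t ^+ 4 = 0.
  move=> t; rewrite -[RHS](E t) (det_mx44 (D4 t)) /D4 /= /det3 !netE.
  case: F => -> -> -> -> -> -> -> -> ->.
  rewrite k1 k2 k3 w1 w2 w3 k4 -/c1 -/c2 -/c3 -/b1 -/b2 -/b3 -/d.
  rewrite -/a11 -/a12 -/a13 -/a21 -/a22 -/a23 -/a31 -/a32 -/a33.
  rewrite /cAAb /cAb /cb /e2 /tr /d1 /d2 /d3 /A1 /A2 /A3.
  rewrite -/a11 -/a12 -/a13 -/a21 -/a22 -/a23 -/a31 -/a32 -/a33.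
  by ring.
move=> d0; rewrite d0 !mul0r !sub0r => /eqP; rewrite oppr_eq0 => /eqP cb0.
rewrite cb0 !mulr0 sub0r !opprK addr0 => cAb0.
by rewrite cAb0 mulr0 subr0 => /eqP; rewrite oppr_eq0 => /eqP.
Qed.

Lemma coker_ker0 h u y : in_coker h -> in_ker u -> B h y u = 0.
Proof. by move=> Ch Ku; have [] := @frame_relations h u y Ch Ku. Qed.

Lemma coker_e h y : in_coker h -> B h e y = 0.
Proof. by case=> k1 k2 k3; rewrite frame_sum k1 k2 k3 !mul0r !addr0. Qed.

Lemma ker_e h u : in_ker u -> B h e u = 0.
Proof. by case=> k1 k2 k3; rewrite frame_sum k1 k2 k3 !mulr0 !addr0. Qed.

Lemma frame_split y : exists2 u, in_ker u &
  y = B h1 e y *: v1 + B h2 e y *: v2 + B h3 e y *: v3 + u.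
Proof.
exists (y - (B h1 e y *: v1 + B h2 e y *: v2 + B h3 e y *: v3));
  last by rewrite addrC subrK.
by case: F => E1 E2 E3 E4 E5 E6 E7 E8 E9; split;
  rewrite !netE ?(E1, E2, E3, E4, E5, E6, E7, E8, E9); ring.
Qed.

Lemma coframe_split h : exists2 h0, in_coker h0 &
  h = B h e v1 *: h1 + B h e v2 *: h2 + B h e v3 *: h3 + h0.
Proof.
exists (h - (B h e v1 *: h1 + B h e v2 *: h2 + B h e v3 *: h3));
  last by rewrite addrC subrK.
by case: F => E1 E2 E3 E4 E5 E6 E7 E8 E9; split;
  rewrite !netE ?(E1, E2, E3, E4, E5, E6, E7, E8, E9); ring.
Qed.

Lemma frame_ext (f : V -> L) : scalar f ->
  f v1 = 0 -> f v2 = 0 -> f v3 = 0 -> (forall u, in_ker u -> f u = 0) ->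
  forall y, f y = 0.
Proof.
move=> fL f1 f2 f3 fU y; have [u Uu ->] := frame_split y.
by rewrite -!addrA !fL f1 f2 f3 (fU u Uu) !mulr0 !addr0.
Qed.

(** Forms that vanish on the image of beta(e, -) are forms on the 3-dimensional
    quotient of the source by the kernel. *)
Lemma coker_expand h y z : in_coker h -> B h y z =
  B h1 e y * (B h1 e z * B h v1 v1 + B h2 e z * B h v1 v2 + B h3 e z * B h v1 v3)
+ B h2 e y * (B h1 e z * B h v1 v2 + B h2 e z * B h v2 v2 + B h3 e z * B h v2 v3)
+ B h3 e y * (B h1 e z * B h v1 v3 + B h2 e z * B h v2 v3 + B h3 e z * B h v3 v3).
Proof.
move=> ch; have [u Uu Ey] := frame_split y; have [w Uw Ez] := frame_split z.
rewrite {1}Ey {1}Ez !netE !(coker_ker0 _ ch Uw) ?(net_sym netB _ u).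
rewrite !(coker_ker0 _ ch Uu) !(net_sym netB _ v3 v2) !(net_sym netB _ v3 v1).
by rewrite !(net_sym netB _ v2 v1); ring.
Qed.
End Frame.

(** S contains a subspace of codimension at most k: the common kernel of k linear
    forms. *)
Definition codim_le (X : lmodType L) (k : nat) (S : X -> Prop) :=
  exists2 phi : X -> 'rV[L]_k, linear phi & forall x, phi x = 0 -> S x.

Lemma codim_le_seq (X : lmodType L) (S : X -> Prop) (s : seq (X -> L)) :
  (forall i, (i < size s)%N -> scalar (nth (fun=> 0) s i)) ->
  (forall x, (forall i, (i < size s)%N -> nth (fun=> 0) s i x = 0) -> S x) ->
  codim_le (size s) S.
Proof.
move=> sL sS; exists (fun x => \row_(i < size s) nth (fun=> 0) s i x).
  by move=> a x y; apply/rowP => i; rewrite !mxE sL.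
by move=> x /rowP x0; apply: sS => i si; have := x0 (Ordinal si); rewrite !mxE.
Qed.

Definition small_span := codim_le 3 (fun h => forall x y, B h x y = 0).
Definition small_radical k := codim_le k (fun u => forall h z, B h z u = 0).
(** The linear form w on the linear forms h is a vector of the target; modulo the
    line that it spans, beta factors through a quotient of dimension k. *)
Definition pencil k := exists2 w : D -> L, scalar w &
  codim_le k (fun u => forall h z, w h = 0 -> B h z u = 0).

Lemma scalar_net_l h y : scalar (fun x => B h x y).
Proof. by move=> a x x'; rewrite !netE. Qed.
Lemma scalar_net_r h y : scalar (fun x => B h y x).
Proof. by move=> a x x'; rewrite !netE. Qed.
Lemma scalar_net_h x y : scalar (fun h => B h x y).
Proof. by move=> a h h'; rewrite !netE. Qed.

(** On suitable lines a + t b, then y + t c, the product of the three forms would be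
    a nonzero polynomial in t. *)
Lemma scalar_avoid3 (f g k : V -> L) : scalar f -> scalar g -> scalar k ->
  (forall y, f y * g y * k y = 0) ->
  [\/ forall y, f y = 0, forall y, g y = 0 | forall y, k y = 0].
Proof.
move=> fL gL kL P.
have scD (q : V -> L) : scalar q -> forall t a b, q (a + t *: b) = q a + t * q b.
  by move=> qL t a b; rewrite addrC qL addrC.
have [|nf] := classic (forall y, f y = 0); first by constructor 1.
have [|ng] := classic (forall y, g y = 0); first by constructor 2.
have [|nk] := classic (forall y, k y = 0); first by constructor 3.
have [a /eqP fa] := not_all_ex_not _ _ nf.
have [b /eqP gb] := not_all_ex_not _ _ ng.
have [c /eqP kc] := not_all_ex_not _ _ nk.
have lin_ne0 (q : V -> L) x y : (q x != 0) || (q y != 0) ->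
    ((q x)%:P + (q y)%:P * 'X : {poly L}) != 0.
  move=> qxy; apply/eqP => /polyP p0; have := p0 0%N; have := p0 1%N.
  rewrite !coefD !coefC !coefMX !coefC /= add0r addr0 => qy qx.
  by move: qxy; rewrite qx qy eqxx.
have [y /andP[fy gy]] : exists y, (f y != 0) && (g y != 0).
  have pn0 : ((f a)%:P + (f b)%:P * 'X) * ((g a)%:P + (g b)%:P * 'X) != 0.
    by rewrite mulf_neq0 ?lin_ne0 ?fa ?gb ?orbT.
  have [t] : exists t, (((f a)%:P + (f b)%:P * 'X) * ((g a)%:P + (g b)%:P * 'X)).[t] <> 0.
    by apply: not_all_ex_not => /Linf/eqP; apply/negP.
  rewrite !hornerE => /eqP; rewrite mulf_eq0 negb_or mulrC [X in _ && (_ + X != 0)]mulrC.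
  by rewrite -!scD // => /andP[]; exists (a + t *: b); apply/andP.
have pn0 : ((f y)%:P + (f c)%:P * 'X) * ((g y)%:P + (g c)%:P * 'X)
         * ((k y)%:P + (k c)%:P * 'X) != 0.
  by rewrite !mulf_neq0 ?lin_ne0 ?fy ?gy ?kc ?orbT.
have [] : exists t, (((f y)%:P + (f c)%:P * 'X) * ((g y)%:P + (g c)%:P * 'X)
         * ((k y)%:P + (k c)%:P * 'X)).[t] <> 0.
  by apply: not_all_ex_not => /Linf/eqP; apply/negP.
move=> t; rewrite !hornerE; case; rewrite -[RHS](P (y + t *: c)) !scD //; ring.
Qed.

Lemma scalar_avoid2 (f g : V -> L) : scalar f -> scalar g ->
  (forall y, f y * g y = 0) -> (forall y, f y = 0) \/ (forall y, g y = 0).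
Proof.
move=> fL gL P; have [] := @scalar_avoid3 f g g fL gL gL; [|by left|by right|by right].
by move=> y; rewrite P mul0r.
Qed.
End Net.

(** * Characteristic other than two *)

Lemma double_eq0 (F : fieldType) : 2%:R != 0 :> F -> forall x : F, x + x = 0 -> x = 0.
Proof.
by move=> two0 x /eqP; rewrite -mulr2n -mulr_natl mulf_eq0 (negPf two0) => /eqP.
Qed.

Lemma eq0_comb (F : fieldType) (x a b : F) :
  a = 0 -> b = 0 -> forall c, x = a + c * b -> x = 0.
Proof. by move=> -> -> c ->; rewrite mulr0 addr0. Qed.

Section NetCases.
Variables (L : fieldType) (D V : lmodType L) (B : D -> V -> V -> L).
Hypotheses (netB : is_net B) (Linf : infinite_field L)
  (rank3 : bounded_rank3 B).
Let netE := netE netB.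
Let Bsym := net_sym netB.

(** For h outside the span of h1, h2, h3 the form B h already vanishes on the kernel,
    by the relation d = 0. *)
Lemma radical_of_kernel e v1 v2 v3 h1 h2 h3 (s : seq (V -> L)) :
  frame B e v1 v2 v3 h1 h2 h3 ->
  (forall i, (i < size s)%N -> scalar (nth (fun=> 0) s i)) ->
  (forall u y, in_ker B e h1 h2 h3 u ->
     (forall i, (i < size s)%N -> nth (fun=> 0) s i u = 0) ->
     [/\ B h1 y u = 0, B h2 y u = 0 & B h3 y u = 0]) ->
  small_radical B (3 + size s).
Proof.
move=> F sL H.
apply: (@codim_le_seq _ _ _ [:: B h1 e, B h2 e, B h3 e & s]).
  move=> [|[|[|i]]] //= => [_|_|_|]; try exact: scalar_net_r.
  by rewrite !ltnS; apply: sL.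
move=> u u0 h z.
have Ku : in_ker B e h1 h2 h3 u.
  by split; [apply: (u0 0%N)|apply: (u0 1%N)|apply: (u0 2%N)].
have [|k1 k2 k3] := H u z Ku; first by move=> i; apply: (u0 i.+3).
have [h0 Ch0 ->] := coframe_split netB F h.
by rewrite !netE k1 k2 k3 (coker_ker0 netB Linf rank3 F _ Ch0 Ku) !mulr0 !addr0.
Qed.

(** The infinitesimal symmetry J of [form5]. The point e and the last but one clause
    are what makes J unique up to a scalar. *)
Definition twisted := exists (e : V) (J : V -> V) (c : L),
  [/\ linear J, c != 0, exists h, B h e e != 0,
      forall h x y, B h (J x) y + B h x (J y) = 0 &
      forall h x y, B h (J (J x)) y = - c * B h x y] /\
  [/\ forall x, (forall h, B h e x = 0) ->
        exists a, forall h z, B h z (x - a *: J e) = 0 &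
      small_radical B 4].

Section OddFrame.
Variables (e v2 v3 : V) (h1 h2 h3 : D).
Hypothesis F : frame B e e v2 v3 h1 h2 h3.
Let rel := frame_relations netB Linf rank3 F.
Let ker := in_ker B e h1 h2 h3.
Let coker := in_coker B e e v2 v3.

Lemma small_span_of_coker : (forall h, coker h ->
    [/\ B h v2 v2 = 0, B h v2 v3 = 0 & B h v3 v3 = 0]) -> small_span B.
Proof.
move=> H; apply: (@codim_le_seq _ _ _ [:: fun h => B h e e; fun h => B h e v2;
   fun h => B h e v3]).
  by move=> [|[|[|i]]] //= _; exact: scalar_net_h.
move=> h h0 x y.
have Ch : coker h by split; [apply: (h0 0%N)|apply: (h0 1%N)|apply: (h0 2%N)].
have [k1 k2 k3] := H h Ch; case: (Ch) => k4 k5 k6.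
rewrite (coker_expand netB Linf rank3 F _ _ Ch) k1 k2 k3 k4 k5 k6.
by rewrite !(mulr0, addr0).
Qed.

(** Some form h vanishing on the image of beta(e, -) has rank one.  Then c b = 0 puts
    beta(V, kernel) in the plane spanned by beta(e, e) and beta(e, v2), while c A b = 0 and
    c A^2 b = 0 shrink it to a line, or to 0 when B h3 v2 v2 is nonzero. *)
Lemma degenerate_case h : (2%:R != 0 :> L) -> coker h ->
  B h v2 v2 = 0 -> B h v2 v3 = 0 -> B h v3 v3 = 1 -> B h3 v2 v3 = 0 ->
  small_radical B 3 \/ pencil B 2.
Proof.
move=> two0 Ch h22 h23 h33 a23.
have [f11 f12 f13 f21 f22 f23 f31 f32 f33] := F.
have fr := (f11, f12, f13, f21, f22, f23, f31, f32, f33).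
have hy1 y : B h y e = 0 by rewrite Bsym (coker_e rank3 F _ Ch).
have hy y z : B h y z = B h3 e y * B h3 e z.
  rewrite (coker_expand netB Linf rank3 F _ _ Ch) h22 h23 h33 !(Bsym h e) !hy1.
  by ring.
have be i u : ker u -> B i e u = 0 by apply: (ker_e rank3 F).
have cancel3 (f : V -> L) : scalar f -> (forall y, B h3 e y * f y = 0) ->
    forall y, f y = 0.
  move=> fL /(scalar_avoid2 Linf) [||p0|//]; [exact: scalar_net_r|exact: fL|].
  by have := p0 v3; rewrite f33 => /eqP; rewrite oner_eq0.
have b3 u : ker u -> forall y, B h3 y u = 0.
  move=> Ku; apply: cancel3; first exact: scalar_net_l.
  move=> y; have [_ r2 _ _] := rel y Ch Ku.
  by rewrite -[RHS]r2 !hy !fr; ring.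
pose a := B h3 v2 v2.
have E y : B h3 y v2 = a * B h2 e y.
  have [u Ku ->] := frame_split netB F y; rewrite !netE.
  by rewrite (Bsym h3 v3) a23 (Bsym h3 u v2) (b3 _ Ku) !fr -/a; case: Ku => _ -> _; ring.
(* E3 and E4 are the relations c A b = 0 and c A^2 b = 0 *)
have E3 u y : ker u -> B h3 e y * (B h3 e y * B h1 y u + a * B h2 e y * B h2 y u) = 0.
  move=> Ku; have [_ _ r3 _] := rel y Ch Ku.
  rewrite -[RHS]r3 !hy !fr (b3 u Ku y) E (Bsym h3 y); ring.
have E4 u y : ker u -> B h3 e y * (
     B h3 e y * (B h1 e y * B h1 y u + B h1 y v2 * B h2 y u)
   + a * B h2 e y * (B h2 e y * B h1 y u + B h2 y v2 * B h2 y u)) = 0.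
  move=> Ku; have [_ _ r3 r4] := rel y Ch Ku.
  move: r3 r4; rewrite !hy !fr (b3 u Ku y) !E !(Bsym _ y e) => r3 r4.
  by apply: (eq0_comb (c := - B h3 y v3) r4 r3); ring.
have rad : (forall u y, ker u -> B h1 y u = 0 /\ B h2 y u = 0) -> small_radical B 3.
  move=> b12; apply: (radical_of_kernel (s := [::]) F) => // u y Ku _.
  by have [? ?] := b12 u y Ku; split=> //; apply: b3.
have [a0|a0] := eqVneq a 0.
  have b1 u : ker u -> forall y, B h1 y u = 0.
    move=> Ku; apply: cancel3; first exact: scalar_net_l.
    move=> y; have := E3 u y Ku; rewrite a0 !mul0r addr0 => /eqP.
    by rewrite mulf_eq0 => /orP[] /eqP ->; rewrite ?mul0r.
  have [b2|nb2] := classic (forall u y, ker u -> B h2 y u = 0).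
    by left; apply: rad => u y Ku; split; [apply: b1|apply: b2].
  have [u nu] := not_all_ex_not _ _ nb2.
  have [y0 ny] := not_all_ex_not _ _ nu; have [Ku b2] := imply_to_and _ _ ny.
  right.
  (* the line is spanned by beta(e, v2), and v2 joins the kernel modulo it *)
  have b1v2 y : B h1 y v2 = 0.
    have [||||p0|//|b20] := @scalar_avoid3 _ _ Linf (B h3 e) (B h1 ^~ v2) (B h2 ^~ u).
    - exact: scalar_net_r.
    - exact: scalar_net_l.
    - exact: scalar_net_l.
    - move=> z; have := E4 u z Ku; rewrite a0 (b1 _ Ku) !(mul0r, mulr0, add0r, addr0).
      move=> /eqP; rewrite mulf_eq0 => /orP[/eqP ->|/eqP E0]; first by rewrite !mul0r.
      by rewrite -mulrA.
    - by have := p0 v3; rewrite f33 => /eqP; rewrite oner_eq0.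
    - by case: b2.
  exists (fun h => B h e v2); first exact: scalar_net_h.
  apply: (@codim_le_seq _ _ _ [:: B h1 e; B h3 e]).
    by move=> [|[|i]] //= _; exact: scalar_net_r.
  move=> x x0; have p1 := x0 0%N isT; have p3 := x0 1%N isT; move: p1 p3 => /= p1 p3.
  move=> i z i2; have [h0 Ch0 ->] := coframe_split netB F i.
  have [w Kw ->] := frame_split netB F x.
  rewrite i2 p1 p3 !netE b1v2 (b1 _ Kw) E a0 (b3 _ Kw).
  rewrite (coker_ker0 netB Linf rank3 F _ Ch0 Kw).
  suff -> : B h0 z v2 = 0 by ring.
  move: z; case: (@scalar_avoid2 _ _ Linf (B h0 ^~ v2) (B h2 ^~ u)) => //.
  - exact: scalar_net_l.
  - exact: scalar_net_l.
  - move=> y; have [_ r2 _ _] := rel y Ch0 Ku.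
    by rewrite -[RHS]r2 (b1 _ Ku) (b3 _ Ku); ring.
left; apply: rad => u y Ku.
have two_eq0 := double_eq0 two0.
have b1v3 : B h1 v3 u = 0 by have := E3 u v3 Ku; rewrite f33 f23; move=> <-; ring.
have b1e := be h1 u Ku; have b2e := be h2 u Ku.
have b1w w : ker w -> B h1 w u = 0.
  move=> Kw; have := E3 u (v3 + w) Ku; rewrite !netE; case: (Kw) => _ -> ->.
  by rewrite f33 f23 b1v3 => <-; ring.
have Ep := E3 u (v3 + v2) Ku; have Em := E3 u (v3 - v2) Ku.
move: Ep Em; rewrite !netE f33 f32 f23 f22 b1v3 => Ep Em.
have b2v2 : B h2 v2 u = 0.
  apply: two_eq0; apply: (mulfI a0); rewrite mulr0.
  by apply: (eq0_comb (c := 1) Ep Em); ring.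
have b1v2 : B h1 v2 u = - a * B h2 v3 u.
  by apply/eqP; rewrite mulNr -addr_eq0 -Ep b2v2; apply/eqP; ring.
have b2w w : ker w -> B h2 w u = 0.
  move=> Kw; have := E3 u (v3 + v2 + w) Ku; rewrite !netE; case: (Kw) => _ -> ->.
  rewrite f33 f32 f23 f22 b1v3 b1v2 b2v2 (b1w _ Kw) => Ew.
  by apply: (mulfI a0); rewrite mulr0 -[RHS]Ew; ring.
have b2v3 : B h2 v3 u = 0.
  (* E4 at v3 + t v2 has - a^2 m as its coefficient of t^3 *)
  pose m := B h2 v3 u.
  have [|_ _ _ /eqP + _] := @poly4_eq0 _ Linf (m * B h1 v3 v2)
    (m * (B h1 v2 v2 + a * B h2 v3 v2)) (m * a * B h2 v2 v2) (- a ^+ 2 * m) 0.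
    move=> t; have := E4 u (v3 + t *: v2) Ku.
    rewrite !netE f33 f32 f13 f12 f23 f22 b1v3 b1v2 b2v2 -/m => E5; rewrite -[RHS]E5; ring.
  by rewrite mulf_eq0 oppr_eq0 expf_eq0 (negPf a0) => /eqP.
split.
  apply: (frame_ext netB F (f := B h1 ^~ u)) => //; first exact: scalar_net_l.
  by rewrite b1v2 b2v3 mulr0.
by apply: (frame_ext netB F (f := B h2 ^~ u)) => //; exact: scalar_net_l.
Qed.

(** The kernel is spanned by u1 modulo the radical, and u1 plays the part of J e.  The
    relations at combinations of v2, v3 and u1 determine the whole table of beta on
    e, v2, v3, u1 up to the four values at (e, e), (e, v2), (e, v3) and (v2, v2); J maps
    e to u1, u1 to - c e, v2 to - v3 and v3 to c v2. *)
Lemma nondegenerate_case_normalized h c u1 : (2%:R != 0 :> L) -> coker h ->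
  c != 0 -> B h v2 v2 = 1 -> B h v2 v3 = 0 -> B h v3 v3 = c ->
  (forall y u, ker u -> B h3 v2 u = 0 -> forall i, B i y u = 0) ->
  (forall y u, ker u -> B h2 e y * B h2 y u + c * B h3 e y * B h3 y u = 0) ->
  ker u1 -> B h3 v2 u1 = 1 -> B h1 v2 u1 = 0 -> B h1 v3 u1 = 0 -> twisted.
Proof.
move=> two0 Ch c0 h22 h23 h33 rad CB Ku1 b32 b12 b13.
have [f11 f12 f13 f21 f22 f23 f31 f32 f33] := F.
have fr := (f11, f12, f13, f21, f22, f23, f31, f32, f33).
have he1 y : B h y e = 0 by rewrite Bsym (coker_e rank3 F _ Ch).
have hy y z : B h y z = B h2 e y * B h2 e z + c * B h3 e y * B h3 e z.
  rewrite (coker_expand netB Linf rank3 F _ _ Ch) h22 h23 h33 !(Bsym h e) !he1.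
  by ring.
have two_eq0 := double_eq0 two0.
have be i : B i e u1 = 0 by apply: (ker_e rank3 F).
have kw w : ker w -> [/\ B h1 e w = 0, B h2 e w = 0 & B h3 e w = 0] by [].
have b22 : B h2 v2 u1 = 0.
  by have := CB v2 u1 Ku1; rewrite !fr => <-; ring.
have b33 : B h3 v3 u1 = 0.
  apply: (mulfI c0); have := CB v3 u1 Ku1; rewrite !fr mulr0 => E.
  by rewrite -[RHS]E; ring.
have b23 : B h2 v3 u1 = - c.
  have := CB (v2 + v3) u1 Ku1; rewrite !netE !fr b22 b32 b33 => E.
  by apply/eqP; rewrite -addr_eq0 -[X in _ == X]E; apply/eqP; ring.
have b2w w : ker w -> B h2 w u1 = 0.
  move=> /kw [_ w2 w3]; have := CB (v2 + w) u1 Ku1.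
  by rewrite !netE !fr w2 w3 b22 => E; rewrite -[RHS]E; ring.
have b3w w : ker w -> B h3 w u1 = 0.
  move=> Kw; have [_ w2 w3] := kw _ Kw; apply: (mulfI c0); have := CB (v3 + w) u1 Ku1.
  by rewrite !netE !fr w2 w3 b23 b33 (b2w w Kw) mulr0 => E; rewrite -[RHS]E; ring.
have r3 y : B h2 e y * (B h2 e y * B h1 y u1 + B h2 y v2 * B h2 y u1
              + B h2 y v3 * B h3 y u1)
   + c * B h3 e y * (B h3 e y * B h1 y u1 + B h3 y v2 * B h2 y u1
              + B h3 y v3 * B h3 y u1) = 0.
  have [_ _ + _] := rel y Ch Ku1; rewrite !hy !fr !(Bsym _ y e) => E.
  by rewrite -[RHS]E; ring.
have A1 := r3 v2; have A2 := r3 v3; have A3 := r3 (v2 + v3).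
have A4 := r3 (v2 - v3); have A5 := r3 (v2 + u1).
have [w1 w2 w3] := kw _ Ku1.
rewrite !netE !fr b12 b13 b22 b23 b32 b33 !(Bsym _ v3 v2) in A1 A2 A3 A4 A5.
have z2 : B h2 v2 v3 = 0 by rewrite -[RHS]A1; ring.
have z3 : B h3 v2 v3 = 0.
  by apply: (mulfI c0); apply: (mulfI c0); rewrite !mulr0 -[RHS](oppr0) -A2; ring.
have b14 : B h1 u1 u1 = c.
  move: A5; rewrite w2 w3 (b2w _ Ku1) (b3w _ Ku1) (Bsym h2 u1 v3) b23 z2.
  by move=> A5; apply/eqP; rewrite -subr_eq0 -[X in _ == X]A5; apply/eqP; ring.
rewrite z2 z3 in A3 A4.
have x3 : B h3 v3 v3 = c * B h3 v2 v2.
  apply/eqP; rewrite -subr_eq0; apply/eqP; apply: (mulfI c0); rewrite mulr0.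
  by apply: two_eq0; apply: (eq0_comb (c := 1) A3 A4); ring.
have x2 : B h2 v3 v3 = c * B h2 v2 v2.
  apply/eqP; rewrite -subr_eq0; apply/eqP.
  by apply: two_eq0; apply: (eq0_comb (c := - 1) A3 A4); ring.
have r4 y : let d1 := B h1 e y * B h1 y u1 + B h1 y v2 * B h2 y u1
                   + B h1 y v3 * B h3 y u1 in
     let d2 := B h2 e y * B h1 y u1 + B h2 y v2 * B h2 y u1
                   + B h2 y v3 * B h3 y u1 in
     let d3 := B h3 e y * B h1 y u1 + B h3 y v2 * B h2 y u1
                   + B h3 y v3 * B h3 y u1 in
    B h2 e y * (B h2 e y * d1 + B h2 y v2 * d2 + B h2 y v3 * d3)
   + c * B h3 e y * (B h3 e y * d1 + B h3 y v2 * d2 + B h3 y v3 * d3) = 0.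
  move=> d1 d2 d3; have [_ _ _ +] := rel y Ch Ku1.
  rewrite !hy !fr !(Bsym _ y e) -/d1 -/d2 -/d3 => E.
  by rewrite -[RHS]E; ring.
have z1 : B h1 v2 v3 = 0.
  have := r4 v2; rewrite /= !fr b12 b22 b32 z2 z3 => E.
  by rewrite -[RHS]E; ring.
(* at v2 + t v3 the relation c A^2 b = 0 reads t (1 + c t^2) x = 0 *)
have x1 : B h1 v3 v3 = c * B h1 v2 v2.
  pose x := B h1 v3 v3 - c * B h1 v2 v2.
  have [|_ /eqP + _ _ _] := @poly4_eq0 _ Linf 0 x 0 (c * x) 0.
    move=> t; have := r4 (v2 + t *: v3).
    rewrite !netE !fr b12 b13 b22 b23 b32 b33 !(Bsym _ v3 v2) z1 z2 z3 x2 x3.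
    by move=> E; rewrite -[RHS]E /x; ring.
  by rewrite subr_eq0 => /eqP.
have H0 h0 : coker h0 -> B h0 v2 v3 = 0 /\ B h0 v3 v3 = c * B h0 v2 v2.
  move=> Ch0; have he0 y : B h0 y e = 0 by rewrite Bsym (coker_e rank3 F _ Ch0).
  have z0 : B h0 v2 v3 = 0.
    have [_ E _ _] := rel v2 Ch0 Ku1.
    by rewrite -[RHS]E he0 b12 b22 b32; ring.
  split=> //; have [_ E _ _] := rel (v2 + v3) Ch0 Ku1; apply/eqP.
  rewrite -subr_eq0 -[X in _ == X]E !netE !he0 b22 b23 b32 b33 (Bsym h0 v3 v2) z0.
  by apply/eqP; ring.
have q23 i : B i v2 v3 = 0.
  have [i0 Ci ->] := coframe_split netB F i; rewrite !netE z1 z2 z3.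
  by have [-> _] := H0 _ Ci; ring.
have q33 i : B i v3 v3 = c * B i v2 v2.
  have [i0 Ci ->] := coframe_split netB F i; rewrite !netE x1 x2 x3.
  by have [_ ->] := H0 _ Ci; ring.
have cku i y w : coker i -> ker w -> B i y w = 0.
  by move=> Ci Kw; apply: (coker_ker0 netB Linf rank3 F _ Ci Kw).
have q24 i : B i v2 u1 = B i e v3.
  have [i0 Ci ->] := coframe_split netB F i; rewrite !netE b12 b22 b32 !fr.
  by rewrite (cku _ _ _ Ci) // (coker_e rank3 F _ Ci); ring.
have q34 i : B i v3 u1 = - c * B i e v2.
  have [i0 Ci ->] := coframe_split netB F i; rewrite !netE b13 b23 b33 !fr.
  by rewrite (cku _ _ _ Ci) // (coker_e rank3 F _ Ci); ring.
have q44 i : B i u1 u1 = c * B i e e.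
  have [i0 Ci ->] := coframe_split netB F i.
  rewrite !netE b14 (b2w _ Ku1) (b3w _ Ku1) !fr.
  by rewrite (cku _ _ _ Ci) // (coker_e rank3 F _ Ci); ring.
(* p4 is the coordinate along u1, the other three being B h1 e, B h2 e and B h3 e *)
pose p4 y := B h3 v2 (y - (B h1 e y *: e + B h2 e y *: v2 + B h3 e y *: v3)).
have p4L : scalar p4 by move=> a y y'; rewrite /p4 !netE; ring.
have split4 y : exists2 w, forall i z, B i z w = 0 &
    y = B h1 e y *: e + B h2 e y *: v2 + B h3 e y *: v3 + p4 y *: u1 + w.
  have [w Kw Ey] := frame_split netB F y; exists (w - p4 y *: u1); last first.
    by rewrite addrACA -addrA subrr addr0 -Ey.
  have Ew : p4 y = B h3 v2 w by rewrite /p4 {1}Ey addrC addKr.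
  move=> i z; apply: rad; last by rewrite !netE Ew b32 mulr1 subrr.
  have [k1 k2 k3] := kw _ Kw.
  by split; rewrite !netE ?k1 ?k2 ?k3 ?w1 ?w2 ?w3; ring.
have BE i x y : B i x y =
    (B h1 e x * B h1 e y + c * (p4 x * p4 y)) * B i e e
  + (B h1 e x * B h2 e y + B h2 e x * B h1 e y
     - c * (B h3 e x * p4 y + p4 x * B h3 e y)) * B i e v2
  + (B h1 e x * B h3 e y + B h3 e x * B h1 e y
     + (B h2 e x * p4 y + p4 x * B h2 e y)) * B i e v3
  + (B h2 e x * B h2 e y + c * (B h3 e x * B h3 e y)) * B i v2 v2.
  have [wx Wx {1}->] := split4 x; have [wy Wy {1}->] := split4 y.
  rewrite !netE !Wy !(Bsym _ wx) !Wx !(Bsym _ _ e) !(Bsym _ u1) !(Bsym _ v3 v2).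
  by rewrite q23 q33 q24 q34 q44 !be; ring.
pose J y := (- c * p4 y) *: e + (c * B h3 e y) *: v2 + (- B h2 e y) *: v3
            + B h1 e y *: u1.
have p4e : p4 e = 0 by rewrite /p4 !fr !netE !(Bsym _ v2 e) !fr; ring.
have p42 : p4 v2 = 0 by rewrite /p4 !fr !netE !(Bsym _ v2 e) !fr; ring.
have p43 : p4 v3 = 0 by rewrite /p4 !fr !netE !(Bsym _ v2 e) !fr; ring.
have p44 : p4 u1 = 1 by rewrite /p4 w1 w2 w3 !netE b32; ring.
have p4D a b : p4 (a + b) = p4 a + p4 b by have := p4L 1 a b; rewrite scale1r mul1r.
have p4Z a b : p4 (a *: b) = a * p4 b.
  have := p4L a b 0; rewrite !addr0 => ->; have := p4L 1 0 0.
  by rewrite scale1r addr0 mul1r => /eqP; rewrite -subr_eq subrr => /eqP <-; rewrite addr0.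
have J1 y : B h1 e (J y) = - c * p4 y by rewrite /J !netE !fr w1; ring.
have J2 y : B h2 e (J y) = c * B h3 e y by rewrite /J !netE !fr w2; ring.
have J3 y : B h3 e (J y) = - B h2 e y by rewrite /J !netE !fr w3; ring.
have J4 y : p4 (J y) = B h1 e y.
  by rewrite /J !p4D !p4Z p4e p42 p43 p44; ring.
exists e, J, c; split; split.
- move=> a x y.
  have comb (f : V -> L) (v : V) : f (a *: x + y) = a * f x + f y ->
      f (a *: x + y) *: v = a *: (f x *: v) + f y *: v.
    by move=> ->; rewrite scalerDl scalerA.
  rewrite /J (comb (fun y => - c * p4 y) e) ?(comb (fun y => c * B h3 e y) v2)
    ?(comb (fun y => - B h2 e y) v3) ?(comb (B h1 e) u1); try by rewrite ?p4L ?netE; ring.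
  by rewrite !scalerDr [RHS]addrACA; congr (_ + _); rewrite [RHS]addrACA;
    congr (_ + _); rewrite [RHS]addrACA.
- by [].
- by exists h1; rewrite f11 oner_eq0.
- by move=> i x y; rewrite (BE i (J x)) (BE i x) !J1 !J2 !J3 !J4; ring.
- by move=> i x y; rewrite (BE i (J _)) (BE i x) !(J1, J2, J3, J4); ring.
- move=> x x0; exists (p4 x) => i z; have [w Ww {1}->] := split4 x.
  rewrite !x0 /J !fr p4e !netE Ww; ring.
- apply: (@codim_le_seq _ _ _ [:: B h1 e; B h2 e; B h3 e; p4]).
    by move=> [|[|[|[|j]]]] //= _; exact: scalar_net_r.
  move=> x x0 i z; have [w Ww ->] := split4 x.
  rewrite (x0 0%N isT : B h1 e x = 0) (x0 1%N isT : B h2 e x = 0).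
  by rewrite (x0 2%N isT : B h3 e x = 0) (x0 3%N isT : p4 x = 0) !netE Ww; ring.
Qed.

(** When h has rank two, c b = 0 says that u acts on the plane spanned by v2 and v3
    as an operator skew for h, so that it is determined by the single number B h3 v2
    u; if this number is 0, only b1 is left, and c A b = 0 reads b1 h(y, y) = 0. *)
Lemma nondegenerate_relations h c : coker h ->
  c != 0 -> B h v2 v2 = 1 -> B h v2 v3 = 0 -> B h v3 v3 = c ->
  (forall y u, ker u -> B h2 e y * B h2 y u + c * B h3 e y * B h3 y u = 0) /\
  (forall y u, ker u -> B h3 v2 u = 0 -> forall i, B i y u = 0).
Proof.
move=> Ch c0 h22 h23 h33.
have [f11 f12 f13 f21 f22 f23 f31 f32 f33] := F.
have fr := (f11, f12, f13, f21, f22, f23, f31, f32, f33).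
have he1 y : B h y e = 0 by rewrite Bsym (coker_e rank3 F _ Ch).
have hy y z : B h y z = B h2 e y * B h2 e z + c * B h3 e y * B h3 e z.
  rewrite (coker_expand netB Linf rank3 F _ _ Ch) h22 h23 h33 !(Bsym h e) !he1.
  by ring.
have CB y u : ker u -> B h2 e y * B h2 y u + c * B h3 e y * B h3 y u = 0.
  move=> Ku; have [_ E _ _] := rel y Ch Ku.
  by rewrite -[RHS]E !hy !fr; ring.
split=> // y u Ku b32; move: y.
have kw w : ker w -> [/\ B h1 e w = 0, B h2 e w = 0 & B h3 e w = 0] by [].
have be i : B i e u = 0 by apply: (ker_e rank3 F).
have b22 : B h2 v2 u = 0.
  by have := CB v2 u Ku; rewrite !fr => E; rewrite -[RHS]E; ring.
have b33 : B h3 v3 u = 0.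
  apply: (mulfI c0); have := CB v3 u Ku; rewrite !fr mulr0 => E.
  by rewrite -[RHS]E; ring.
have b23 : B h2 v3 u = 0.
  have := CB (v2 + v3) u Ku; rewrite !netE !fr b22 b32 b33 => E.
  by rewrite -[RHS]E; ring.
have b2 y : B h2 y u = 0.
  apply: (frame_ext netB F (f := B h2 ^~ u)) => // [|w Kw]; first exact: scalar_net_l.
  have [_ w2 w3] := kw _ Kw; have := CB (v2 + w) u Ku.
  by rewrite !netE !fr w2 w3 b22 => E; rewrite -[RHS]E; ring.
have b3 y : B h3 y u = 0.
  apply: (frame_ext netB F (f := B h3 ^~ u)) => // [|w Kw]; first exact: scalar_net_l.
  have [_ w2 w3] := kw _ Kw; apply: (mulfI c0); have := CB (v3 + w) u Ku.
  by rewrite !netE !fr w2 w3 b2 b33 mulr0 => E; rewrite -[RHS]E; ring.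
have r3 y : B h1 y u * (B h2 e y ^+ 2 + c * B h3 e y ^+ 2) = 0.
  have [_ _ + _] := rel y Ch Ku; rewrite !hy !fr !(Bsym _ y e) b2 b3 => E.
  by rewrite -[RHS]E; ring.
have b12 : B h1 v2 u = 0 by have := r3 v2; rewrite !fr => E; rewrite -[RHS]E; ring.
have b13 : B h1 v3 u = 0.
  by apply: (mulfI c0); rewrite mulr0; have := r3 v3; rewrite !fr => E; rewrite -[RHS]E; ring.
have b1 y : B h1 y u = 0.
  apply: (frame_ext netB F (f := B h1 ^~ u)) => // [|w Kw]; first exact: scalar_net_l.
  have [_ w2 w3] := kw _ Kw; have := r3 (v2 + w).
  by rewrite !netE !fr w2 w3 b12 => E; rewrite -[RHS]E; ring.
move=> y i; have [i0 Ci ->] := coframe_split netB F i.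
by rewrite !netE b1 b2 b3 (coker_ker0 netB Linf rank3 F _ Ci Ku); ring.
Qed.
End OddFrame.

Lemma frame_shift e v2 v3 h1 h2 h3 a b : frame B e e v2 v3 h1 h2 h3 ->
  frame B e e (v2 + a *: e) (v3 + b *: e) (h1 - a *: h2 - b *: h3) h2 h3.
Proof.
by case=> E1 E2 E3 E4 E5 E6 E7 E8 E9; split;
  rewrite ?netE ?(E1, E2, E3, E4, E5, E6, E7, E8, E9); ring.
Qed.

Lemma frame_mix e v1 v2 v3 h1 h2 h3 a b c d : frame B e v1 v2 v3 h1 h2 h3 ->
  a * d - b * c = 1 ->
  frame B e v1 (a *: v2 + b *: v3) (c *: v2 + d *: v3)
    h1 (d *: h2 - c *: h3) (a *: h3 - b *: h2).
Proof.
move=> [E1 E2 E3 E4 E5 E6 E7 E8 E9] D1; split;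
  rewrite ?netE ?(E1, E2, E3, E4, E5, E6, E7, E8, E9); try (by ring);
  by rewrite -[RHS]D1; ring.
Qed.

(** If the kernel is not in the radical, a vector u1 of the kernel acts
    nontrivially, and a shift of v2 and v3 by multiples of e makes B h1 v2 u1 and B
    h1 v3 u1 vanish. *)
Lemma nondegenerate_case e v2 v3 h1 h2 h3 h c : frame B e e v2 v3 h1 h2 h3 ->
  (2%:R != 0 :> L) -> in_coker B e e v2 v3 h -> c != 0 ->
  B h v2 v2 = 1 -> B h v2 v3 = 0 -> B h v3 v3 = c ->
  small_radical B 3 \/ twisted.
Proof.
move=> F two0 Ch c0 h22 h23 h33.
have [CB rad] := nondegenerate_relations F Ch c0 h22 h23 h33.
have [lam0|nlam] := classic (forall u, in_ker B e h1 h2 h3 u -> B h3 v2 u = 0).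
  left; apply: (radical_of_kernel (s := [::]) F) => // u y Ku _.
  by split; apply: (rad y u Ku); apply: lam0.
have [u nu] := not_all_ex_not _ _ nlam.
have [Ku /eqP lu0] := imply_to_and _ _ nu; right.
have [f11 f12 f13 f21 f22 f23 f31 f32 f33] := F.
have fr := (f11, f12, f13, f21, f22, f23, f31, f32, f33).
have [k1 k2 k3] := Ku; have [c1 c2 c3] := Ch.
have [u1 Ku1 l1] : exists2 u1, in_ker B e h1 h2 h3 u1 & B h3 v2 u1 = 1.
  exists ((B h3 v2 u)^-1 *: u); last by rewrite netE mulVf.
  by split; rewrite netE ?(k1, k2, k3) mulr0.
have b22 : B h2 v2 u1 = 0.
  by have := CB v2 u1 Ku1; rewrite !fr => E; rewrite -[RHS]E; ring.
have b33 : B h3 v3 u1 = 0.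
  apply: (mulfI c0); have := CB v3 u1 Ku1; rewrite !fr mulr0 => E.
  by rewrite -[RHS]E; ring.
have b23 : B h2 v3 u1 = - c.
  have := CB (v2 + v3) u1 Ku1; rewrite !netE !fr b22 l1 b33 => E.
  by apply/eqP; rewrite -addr_eq0 -[X in _ == X]E; apply/eqP; ring.
pose a := - (B h1 v3 u1 / c); pose b := B h1 v2 u1.
have F' := frame_shift a b F.
have be i : B i e u1 = 0 by apply: (ker_e rank3 F).
have he y : B h e y = 0 by apply: (coker_e rank3 F).
have Ch' : in_coker B e e (v2 + a *: e) (v3 + b *: e) h by split; apply: he.
have sub w : in_ker B e (h1 - a *: h2 - b *: h3) h2 h3 w -> in_ker B e h1 h2 h3 w.
  by case; rewrite !netE => + w2 w3; rewrite w2 w3 !mulr0 !subr0.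
apply: (nondegenerate_case_normalized F' two0 Ch' c0 (u1 := u1)).
- by rewrite !netE !(Bsym h _ e) !he h22; ring.
- by rewrite !netE !(Bsym h _ e) !he h23; ring.
- by rewrite !netE !(Bsym h _ e) !he h33; ring.
- move=> y w /sub Kw; rewrite (net_addl netB) (net_scalel netB).
  rewrite (ker_e rank3 F _ Kw) mulr0 addr0 => lw i; exact: rad.
- by move=> y w /sub; apply: CB.
- by case: Ku1 => x1 x2 x3; split; rewrite ?netE ?(x1, x2, x3) //; ring.
- by rewrite !netE be l1; ring.
- by rewrite !netE !be l1 b22 /b; ring.
- by rewrite !netE !be b33 b23 /a; field.
Qed.
End NetCases.

(** * The classification over an infinite field *)

Section NetClassification.
Variables (L : fieldType) (D V : lmodType L) (B : D -> V -> V -> L).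
Hypotheses (netB : is_net B) (Linf : infinite_field L)
  (rank3 : bounded_rank3 B).
Let netE := netE netB.
Let Bsym := net_sym netB.

(** Gram-Schmidt: a nonzero symmetric form takes a nonzero value on one of v2, v3 and
    v2 + v3, since 2 is invertible. *)
Lemma diagonal_frame e v2 v3 h1 h2 h3 h : frame B e e v2 v3 h1 h2 h3 ->
  (2%:R != 0 :> L) -> in_coker B e e v2 v3 h ->
  ~ [/\ B h v2 v2 = 0, B h v2 v3 = 0 & B h v3 v3 = 0] ->
  exists w2 w3 k2 k3, [/\ frame B e e w2 w3 h1 k2 k3,
     B h w2 w3 = 0 & B h w3 w3 != 0].
Proof.
move=> F two0 Ch nz.
have [h33|h33] := eqVneq (B h v3 v3) 0; last first.
  have D1 : 1 * 1 - (- (B h v2 v3 / B h v3 v3)) * 0 = 1 :> L by ring.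
  have F1 := frame_mix netB F D1; do 4 eexists; split; first exact: F1.
    by rewrite !netE (Bsym h v3 v2); field.
  by rewrite !netE !(mul0r, mulr0, add0r, addr0, mul1r).
have [h22|h22] := eqVneq (B h v2 v2) 0; last first.
  have D1 : (B h v2 v3 / B h v2 v2) * 0 - (-1) * 1 = 1 :> L by ring.
  have F1 := frame_mix netB F D1; do 4 eexists; split; first exact: F1.
    by rewrite !netE (Bsym h v3 v2); field.
  by rewrite !netE !(mul0r, mulr0, add0r, addr0, mul1r).
have h23 : B h v2 v3 != 0 by apply/eqP => h23; apply: nz.
have D1 : (2%:R)^-1 * 1 - (- (2%:R)^-1) * 1 = 1 :> L by field.
have F1 := frame_mix netB F D1; do 4 eexists; split; first exact: F1.
  by rewrite !netE (Bsym h v3 v2) h22 h33; field.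
rewrite !netE (Bsym h v3 v2) h22 h33 !(mul0r, mulr0, add0r, addr0, mul1r).
by rewrite -mulr2n -mulr_natl mulf_neq0.
Qed.

Lemma odd_frame_classification e v2 v3 h1 h2 h3 : (2%:R != 0 :> L) ->
  frame B e e v2 v3 h1 h2 h3 ->
  [\/ small_span B, small_radical B 3, pencil B 2 | twisted B].
Proof.
move=> two0 F0.
have [sp|nsp] := classic (forall h, in_coker B e e v2 v3 h ->
    [/\ B h v2 v2 = 0, B h v2 v3 = 0 & B h v3 v3 = 0]).
  by constructor 1; apply: (small_span_of_coker netB Linf rank3 F0 sp).
have [h nh] := not_all_ex_not _ _ nsp; have [Ch0 nz] := imply_to_and _ _ nh.
have [w2 [w3 [k2 [k3 [F h23 h33]]]]] := diagonal_frame F0 two0 Ch0 nz.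
have he y : B h e y = 0 by apply: (coker_e rank3 F0).
have Ch c a b : in_coker B e e (w2 + a *: e) (w3 + b *: e) (c *: h).
  by split; rewrite !netE !he; ring.
have [h22|h22] := eqVneq (B h w2 w2) 0.
  have F' := frame_shift netB (- B k3 w2 w3) 0 F.
  have [||||r3|p2] := degenerate_case netB Linf rank3 F' two0
     (Ch (B h w3 w3)^-1 _ _); rewrite ?netE ?(Bsym _ _ e) ?he ?h22 ?h23.
  - by ring.
  - by ring.
  - by field.
  - by case: F => _ _ _ _ _ _ -> -> ->; ring.
  - by constructor 2.
  - by constructor 3.
have F' := frame_shift netB 0 0 F.
have [|||r3|p2] := nondegenerate_case netB Linf rank3 F' two0
   (Ch (B h w2 w2)^-1 _ _) (mulf_neq0 (invr_neq0 h22) h33);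
   rewrite ?netE ?(Bsym _ _ e) ?he ?h23.
- by field.
- by ring.
- by ring.
- by constructor 2.
- by constructor 4.
Qed.

Lemma frame_perm12 e v1 v2 v3 h1 h2 h3 :
  frame B e v1 v2 v3 h1 h2 h3 -> frame B e v2 v1 v3 h2 h1 h3.
Proof. by case; split. Qed.

Lemma frame_perm13 e v1 v2 v3 h1 h2 h3 :
  frame B e v1 v2 v3 h1 h2 h3 -> frame B e v3 v2 v1 h3 h2 h1.
Proof. by case; split. Qed.

(** The base point itself enters the frame as v1, as [degenerate_case] and
    [nondegenerate_case] require. *)
Lemma frame_base e v1 v2 v3 h1 h2 h3 : frame B e v1 v2 v3 h1 h2 h3 ->
  B h1 e e != 0 ->
  frame B e e v2 v3 ((B h1 e e)^-1 *: h1)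
    (h2 - (B h2 e e / B h1 e e) *: h1) (h3 - (B h3 e e / B h1 e e) *: h1).
Proof.
move=> [E1 E2 E3 E4 E5 E6 E7 E8 E9] e0; split;
  by rewrite ?netE ?(E1, E2, E3, E4, E5, E6, E7, E8, E9); field.
Qed.

Theorem odd_classification e v1 v2 v3 h1 h2 h3 h : (2%:R != 0 :> L) ->
  frame B e v1 v2 v3 h1 h2 h3 -> B h e e != 0 ->
  [\/ small_span B, small_radical B 3, pencil B 2 | twisted B].
Proof.
move=> two0 F.
have [h1e|h1e] := eqVneq (B h1 e e) 0; last first.
  by move=> _; apply: odd_frame_classification two0 (frame_base F h1e).
have [h2e|h2e] := eqVneq (B h2 e e) 0; last first.
  by move=> _; apply: odd_frame_classification two0 (frame_base (frame_perm12 F) h2e).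
have [h3e|h3e] := eqVneq (B h3 e e) 0; last first.
  by move=> _; apply: odd_frame_classification two0 (frame_base (frame_perm13 F) h3e).
by rewrite (frame_sum rank3 F) h1e h2e h3e !mulr0 !addr0 eqxx.
Qed.

Section Alternating.
Hypotheses (char2 : forall x : L, x + x = 0) (alt : forall h x, B h x x = 0).
Let opp2 (x : L) : - x = x.
Proof. by apply/eqP; rewrite eq_sym -addr_eq0 char2. Qed.

(** Here e lies in the kernel. Identify the image of beta(e, -) with the quotient of
    the source by the kernel; the radical of the form h on it is spanned by v1. The
    relation c b = 0 says that beta(y, u) is lam(u) y modulo v1, so that e, where
    lam is 1, and the kernel of lam split the kernel. If the kernel of lam is not in
    the radical, c A b = 0 shows in the same way that beta(y, v1) is nu y modulo v1,
    so that v1 - nu e joins it in a space X of codimension 3 for which beta(V, X)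
    lies in the line spanned by beta(e, v1). *)
Lemma even_pencil_case e v1 v2 v3 h1 h2 h3 h : frame B e v1 v2 v3 h1 h2 h3 ->
  in_coker B e v1 v2 v3 h ->
  B h v1 v2 = 0 -> B h v1 v3 = 0 -> B h v2 v3 = 1 ->
  small_radical B 4 \/ pencil B 3.
Proof.
move=> F Ch h12 h13 h23.
pose ker := in_ker B e h1 h2 h3.
have rel := frame_relations netB Linf rank3 F.
have [f11 f12 f13 f21 f22 f23 f31 f32 f33] := F.
have fr := (f11, f12, f13, f21, f22, f23, f31, f32, f33).
have hy y z : B h y z = B h2 e y * B h3 e z + B h3 e y * B h2 e z.
  rewrite (coker_expand netB Linf rank3 F _ _ Ch) !alt h12 h13 h23.
  by ring.
have kw w : ker w -> [/\ B h1 e w = 0, B h2 e w = 0 & B h3 e w = 0] by [].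
(* a linear map (N2, N3) to the plane with N(y) proportional to y is a homothety *)
have prop (N2 N3 : V -> L) : scalar N2 -> scalar N3 ->
    (forall y, B h3 e y * N2 y + B h2 e y * N3 y = 0) ->
    (forall y, N2 y = N2 v2 * B h2 e y) /\ (forall y, N3 y = N2 v2 * B h3 e y).
  move=> l2 l3 E.
  have D2 x y : N2 (x + y) = N2 x + N2 y by have := l2 1 x y; rewrite scale1r mul1r.
  have D3 x y : N3 (x + y) = N3 x + N3 y by have := l3 1 x y; rewrite scale1r mul1r.
  have n32 : N3 v2 = 0 by rewrite -[RHS](E v2) !fr; ring.
  have n23 : N2 v3 = 0 by rewrite -[RHS](E v3) !fr; ring.
  have n33 : N3 v3 = N2 v2.
    rewrite -[RHS]opp2; apply/eqP.
    rewrite -addr_eq0 -[X in _ == X](E (v2 + v3)) !D2 !D3 n32 n23.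
    by rewrite !netE !fr; apply/eqP; ring.
  have n31 : N3 v1 = 0.
    by rewrite -[RHS](E (v2 + v1)) !D2 !D3 n32 !netE !fr; ring.
  have n21 : N2 v1 = 0.
    by rewrite -[RHS](E (v3 + v1)) !D2 !D3 n23 !netE !fr; ring.
  have n3u u : ker u -> N3 u = 0.
    move=> /kw [_ u2 u3].
    by rewrite -[RHS](E (v2 + u)) !D2 !D3 n32 !netE !fr u2 u3; ring.
  have n2u u : ker u -> N2 u = 0.
    move=> /kw [_ u2 u3].
    by rewrite -[RHS](E (v3 + u)) !D2 !D3 n23 !netE !fr u2 u3; ring.
  split=> y; apply/eqP; rewrite -subr_eq0; apply/eqP; move: y.
    apply: (frame_ext netB F (f := fun y => N2 y - N2 v2 * B h2 e y)).
    - by move=> a x y; rewrite l2 !netE; ring.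
    - by rewrite n21 fr; ring.
    - by rewrite fr; ring.
    - by rewrite n23 fr; ring.
    - by move=> u Ku; rewrite (n2u _ Ku); have [_ -> _] := kw _ Ku; ring.
  apply: (frame_ext netB F (f := fun y => N3 y - N2 v2 * B h3 e y)).
  - by move=> a x y; rewrite l3 !netE; ring.
  - by rewrite n31 fr; ring.
  - by rewrite n32 fr; ring.
  - by rewrite n33 fr; ring.
  - by move=> u Ku; rewrite (n3u _ Ku); have [_ _ ->] := kw _ Ku; ring.
pose lam u := B h2 v2 u.
have lam23 u : ker u ->
    (forall y, B h2 y u = lam u * B h2 e y) /\ (forall y, B h3 y u = lam u * B h3 e y).
  move=> Ku; apply: (prop (B h2 ^~ u) (B h3 ^~ u)).
  - exact: scalar_net_l.
  - exact: scalar_net_l.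
  - move=> y; have [_ E _ _] := rel h u y Ch Ku.
    by rewrite -[RHS]E !hy !fr; ring.
have cku i y w : in_coker B e v1 v2 v3 i -> ker w -> B i y w = 0.
  by move=> Ci Kw; apply: (coker_ker0 netB Linf rank3 F _ Ci Kw).
have [b1|nb1] := classic (forall u, ker u -> lam u = 0 -> forall y, B h1 y u = 0).
  left; apply: (radical_of_kernel netB Linf rank3 (s := [:: lam]) F).
    by case=> //= _; apply: scalar_net_r.
  move=> u y Ku /(_ 0%N isT) /= lu; have [E2 E3] := lam23 u Ku.
  by rewrite E2 E3 lu !mul0r b1.
have [u nu] := not_all_ex_not _ _ nb1.
have [Ku nu'] := imply_to_and _ _ nu; have [lu nu2] := imply_to_and _ _ nu'.
have [E2 E3] := lam23 u Ku; right.
have v1lin (f : V -> L) : scalar f -> (forall y, f y * B h1 y u = 0) -> forall y, f y = 0.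
  by move=> fL /(scalar_avoid2 Linf) [||//|b10]; [exact: fL|exact: scalar_net_l|].
have v1quad y : B h3 e y * B h2 y v1 + B h2 e y * B h3 y v1 = 0.
  pose g z := B h3 e z * B h2 z v1 + B h2 e z * B h3 z v1.
  have gE z : g z * B h1 z u = 0.
    have [_ _ E _] := rel h u z Ch Ku; rewrite -[RHS]E !hy !fr E2 E3 lu /g.
    by ring.
  have [y0 /eqP b0] := not_all_ex_not _ _ nu2.
  have [by0|by0] := eqVneq (B h1 y u) 0; last first.
    by apply/eqP; have /eqP := gE y; rewrite mulf_eq0 (negPf by0) orbF.
  pose k1 := B h3 e y * B h2 y0 v1 + B h3 e y0 * B h2 y v1
    + (B h2 e y * B h3 y0 v1 + B h2 e y0 * B h3 y v1).
  have [|/= _ + _ _ _] := @poly4_eq0 _ Linf 0 (g y * B h1 y0 u)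
     (k1 * B h1 y0 u) (g y0 * B h1 y0 u) 0.
    move=> t; have := gE (y + t *: y0); rewrite /g !netE by0 => E.
    by rewrite -[RHS]E /k1 /g; ring.
  by move=> /eqP; rewrite mulf_eq0 (negPf b0) orbF => /eqP.
have [N2 N3] := prop (B h2 ^~ v1) (B h3 ^~ v1) (scalar_net_l netB _ _)
   (scalar_net_l netB _ _) v1quad.
have N0 i : in_coker B e v1 v2 v3 i -> forall y, B i y v1 = 0.
  move=> Ci; apply: v1lin; first exact: scalar_net_l.
  move=> y; have [_ E _ _] := rel i u y Ci Ku.
  by rewrite -[RHS]E E2 E3 lu; ring.
have Ke : ker e by split; apply: alt.
have le : lam e = 1 by rewrite /lam Bsym fr.
exists (fun i => B i e v1); first exact: scalar_net_h.
pose nu0 := B h2 v2 v1.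
apply: (@codim_le_seq _ _ _ [:: B h2 e; B h3 e;
   fun x => B h2 v2 (x - (B h1 e x *: (v1 - nu0 *: e) + B h2 e x *: v2 + B h3 e x *: v3))]).
  move=> [|[|[|j]]] //= _; try exact: scalar_net_r.
  by move=> a x y; rewrite !netE; ring.
move=> x x0 i z i0; have p2 := x0 0%N isT; have p3 := x0 1%N isT.
have := x0 2%N isT; move: p2 p3 => /= p2 p3.
have [w Kw Ex] := frame_split netB F x.
rewrite {1}Ex p2 p3 => lw.
have {}lw : lam w = - (B h1 e x * nu0).
  apply/eqP; rewrite -addr_eq0 -[X in _ == X]lw; apply/eqP.
  by rewrite !netE (Bsym h2 v2 e) fr /lam; ring.
have [W2 W3] := lam23 w Kw.
have [j Cj Ei] := coframe_split netB F i.
rewrite Ei i0 Ex p2 p3 !netE N2 N3 (N0 _ Cj) W2 W3 lw (cku _ _ _ Cj Kw).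
by rewrite -/nu0; ring.
Qed.

(** An alternating form on a 3-dimensional space has a radical, which is moved to v1. *)
Theorem even_classification e v1 v2 v3 h1 h2 h3 : frame B e v1 v2 v3 h1 h2 h3 ->
  [\/ small_span B, small_radical B 4 | pencil B 3].
Proof.
move=> F0.
have [sp|nsp] := classic (forall h, in_coker B e v1 v2 v3 h ->
    [/\ B h v1 v2 = 0, B h v1 v3 = 0 & B h v2 v3 = 0]).
  constructor 1; apply: (@codim_le_seq _ _ _ [:: fun h => B h e v1; fun h => B h e v2;
     fun h => B h e v3]).
    by move=> [|[|[|i]]] //= _; exact: scalar_net_h.
  move=> h h0 x y.
  have Ch : in_coker B e v1 v2 v3 h.
    by split; [apply: (h0 0%N)|apply: (h0 1%N)|apply: (h0 2%N)].
  have [k1 k2 k3] := sp h Ch.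
  by rewrite (coker_expand netB Linf rank3 F0 _ _ Ch) k1 k2 k3 !alt; ring.
have [h nh] := not_all_ex_not _ _ nsp; have [Ch nz] := imply_to_and _ _ nh.
have he y : B h e y = 0 by apply: (coker_e rank3 F0).
have main w1 w2 w3 k1 k2 k3 : frame B e w1 w2 w3 k1 k2 k3 -> B h w2 w3 != 0 ->
    [\/ small_span B, small_radical B 4 | pencil B 3].
  move=> F h23; pose a := - (B h w1 w3 / B h w2 w3).
  pose b := - (B h w1 w2 / B h w3 w2).
  have F' : frame B e (w1 + a *: w2 + b *: w3) w2 w3 k1 (k2 - a *: k1) (k3 - b *: k1).
    case: F => E1 E2 E3 E4 E5 E6 E7 E8 E9; split;
    by rewrite ?netE ?(E1, E2, E3, E4, E5, E6, E7, E8, E9); ring.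
  have [||||r4|p3] := even_pencil_case (h := (B h w2 w3)^-1 *: h) F'.
  - by split; rewrite (net_scaleh netB) he mulr0.
  - by rewrite !netE alt /b (Bsym h w3 w2); field.
  - by rewrite !netE alt /a; field.
  - by rewrite !netE mulVf.
  - by constructor 2.
  - by constructor 3.
have [h23|h23] := eqVneq (B h v2 v3) 0; last exact: main F0 h23.
have [h13|h13] := eqVneq (B h v1 v3) 0; last exact: main (frame_perm12 F0) h13.
have [h12|h12] := eqVneq (B h v2 v1) 0; last exact: main (frame_perm13 F0) h12.
by case: nz; rewrite h23 h13 Bsym.
Qed.
End Alternating.
End NetClassification.

(** * Quadratic forms as polynomials *)

Section QuadraticForms.
Variables (K : fieldType) (n : nat).

(** A is not assumed symmetric: in characteristic 2 not every quadratic form comes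
    from a symmetric matrix. *)
Definition qform (A : 'M[K]_n) : {mpoly K[n]} :=
  \sum_(k < n) \sum_(j < n) A k j *: ('X_k * 'X_j).

Lemma qformE (A : 'M[K]_n) : let v := \row_j 'X_j : 'rV[{mpoly K[n]}]_n in
  qform A = (v *m map_mx (@mpolyC n K) A *m v^T) 0 0.
Proof.
rewrite /= /qform mxE exchange_big; apply: eq_bigr => j _; rewrite !mxE.
rewrite mulr_suml; apply: eq_bigr => k _; rewrite !mxE.
by rewrite -mul_mpolyC; ring.
Qed.

Lemma qform_comp (A T : 'M[K]_n) :
  qform A \mPo [tuple \sum_(j < n) T i j *: 'X_j | i < n] = qform (T^T *m A *m T).
Proof.
rewrite !qformE.
set lq := [tuple _ | i < n]; set v := \row_j _.
have vE : map_mx (comp_mpoly lq) v = v *m map_mx (@mpolyC n K) T^T.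
  apply/rowP => i; rewrite !mxE comp_mpolyXU -tnth_nth tnth_mktuple.
  by apply: eq_bigr => j _; rewrite !mxE -mul_mpolyC mulrC.
have CE B : map_mx (comp_mpoly lq) (map_mx (@mpolyC n K) B) = map_mx (@mpolyC n K) B
     :> 'M_n.
  by apply/matrixP => i j; rewrite !mxE comp_mpolyC.
transitivity (map_mx (comp_mpoly lq) (v *m map_mx (@mpolyC n K) A *m v^T) 0 0).
  by rewrite [RHS]mxE.
rewrite !map_mxM -matrix.map_trmx vE CE !trmx_mul -matrix.map_trmx trmxK.
by rewrite !mulmxA.
Qed.

Lemma qform_deriv (A : 'M[K]_n) j :
  (qform A)^`M(j) = \sum_(k < n) (A + A^T) k j *: 'X_k.
Proof.
have dX k : ('X_k : {mpoly K[n]})^`M(j) = (k == j)%:R.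
  rewrite mderivX mnm1E; case: eqP => [->|_]; last by rewrite scale0r.
  by rewrite scale1r -[X in (X - _)%MM]add0m addmK mpolyX0.
rewrite /qform linear_sum /=.
under [LHS]eq_bigr => k _ do rewrite linear_sum /=.
transitivity (\sum_(k < n) \sum_(i < n)
   (((k == j)%:R * A k i) *: 'X_i + ((i == j)%:R * A k i) *: 'X_k : {mpoly K[n]})).
  apply: eq_bigr => k _; apply: eq_bigr => i _.
  rewrite linearZ /= mderivM !dX scalerDr -!mul_mpolyC !rmorphM /= !rmorph_nat.
  by ring.
under [LHS]eq_bigr => k _ do rewrite big_split /=.
rewrite big_split /= [X in _ + X]exchange_big /=.
rewrite (bigD1 j) //= [X in _ + X + _]big1 => [|k /negPf kj]; last first.
  by apply: big1 => i _; rewrite kj mul0r scale0r.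
rewrite [X in _ + X](bigD1 j) //= [X in _ + (_ + X)]big1 => [|i /negPf ij]; last first.
  by apply: big1 => k _; rewrite ij mul0r scale0r.
rewrite !addr0 -big_split /=; apply: eq_bigr => k _.
by rewrite !eqxx !mul1r -scalerDl !mxE addrC.
Qed.

Lemma qform_lin m (c : 'I_m -> K) (A : 'I_m -> 'M[K]_n) :
  \sum_i (c i)%:MP * qform (A i) = qform (\sum_i c i *: A i).
Proof.
rewrite /qform; under [LHS]eq_bigr => i _ do rewrite mulr_sumr.
rewrite exchange_big; apply: eq_bigr => k _ /=.
under [LHS]eq_bigr => i _ do rewrite mulr_sumr.
rewrite exchange_big; apply: eq_bigr => j _ /=.
rewrite summxE scaler_suml; apply: eq_bigr => i _.
by rewrite mul_mpolyC scalerA !mxE.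
Qed.

Lemma qformD A B : qform A + qform B = qform (A + B).
Proof.
rewrite /qform -big_split; apply: eq_bigr => k _; rewrite -big_split.
by apply: eq_bigr => j _; rewrite mxE scalerDl.
Qed.

Lemma qform_delta (k j : 'I_n) : qform (delta_mx k j) = 'X_k * 'X_j.
Proof.
rewrite /qform (bigD1 k) //= [X in _ + X]big1.
  rewrite (bigD1 j) //= big1 => [|i /negPf ij]; last by rewrite !mxE ij andbF scale0r.
  by rewrite !mxE !eqxx scale1r !addr0.
by move=> i /negPf ik; rewrite big1 // => l _; rewrite !mxE ik scale0r.
Qed.

Lemma qformZ c A : qform (c *: A) = c *: qform A.
Proof.
rewrite /qform scaler_sumr; apply: eq_bigr => k _; rewrite scaler_sumr.
by apply: eq_bigr => j _; rewrite mxE scalerA.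
Qed.

Lemma qform_tr A : qform A^T = qform A.
Proof.
rewrite /qform exchange_big; apply: eq_bigr => k _; apply: eq_bigr => j _.
by rewrite mxE mulrC.
Qed.

Lemma homog2_qform (p : {mpoly K[n]}) : p \is 2.-homog -> exists A, p = qform A.
Proof.
move=> /dhomogP hp.
have q0 : qform 0 = 0.
  by rewrite /qform big1 // => k _; rewrite big1 // => j _; rewrite mxE scale0r.
have mono (m : 'X_{1..n}) c : mdeg m = 2%N -> exists A, c *: 'X_[m] = qform A.
  move=> m2; have [k [j ->]] : exists k j, m = (U_(k) + U_(j))%MM.
    have [k mk] : exists k, m k != 0%N.
      apply/existsP; apply: contraT; rewrite negb_exists => /forallP m0.
      by move: m2; rewrite mdegE big1 // => i _; apply/eqP; have := m0 i; rewrite negbK.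
    have Em : m = (U_(k) + (m - U_(k)))%MM by rewrite addmC submK // lep1mP.
    move: m2; rewrite {1}Em mdegD mdeg1 add1n => -[] /eqP.
    by rewrite mdeg_eq1 => /existsP[j /eqP Ej]; exists k, j; rewrite {1}Em Ej.
  by exists (c *: delta_mx k j); rewrite qformZ qform_delta mpolyXD.
rewrite [p]mpolyE; elim: (msupp p) hp => [|m s IH] hp.
  by exists 0; rewrite big_nil q0.
have [A EA] := mono m p@_m (hp m (mem_head _ _)).
have [|B EB] := IH; first by move=> x xs; apply: hp; rewrite inE xs orbT.
by exists (A + B); rewrite big_cons EA EB qformD.
Qed.

Lemma euler_qform (A : 'M[K]_n) : (2%:R != 0 :> K) ->
  qform A = 2%:R^-1 *: qform (A + A^T).
Proof.
move=> two0; rewrite -qformD qform_tr -mulr2n -scaler_nat scalerA.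
by rewrite mulVf // scale1r.
Qed.

End QuadraticForms.

Section QuadraticMaps.
Variables (K : fieldType) (m n : nat).

Definition qmap (A : 'I_m -> 'M[K]_n) : polymap K m n := \col_i qform (A i).

Lemma quadratic_homogeneous_qmap (H : polymap K m n) :
  quadratic_homogeneous H -> exists A, H = qmap A.
Proof.
move=> hH; have AP i : exists A, H i 0 = qform A by apply/homog2_qform/hH.
have [s Hs] := fin_all_exists AP.
by exists s; apply/colP => i; rewrite mxE Hs.
Qed.

Definition polar (A : 'I_m -> 'M[K]_n) i := A i + (A i)^T.

Lemma jacobian_qmap A i j :
  jacobian (qmap A) i j = \sum_(k < n) polar A i k j *: 'X_k.
Proof. by rewrite !mxE qform_deriv. Qed.

Definition bvec (Q : 'I_m -> 'M[K]_n) (x y : 'rV[K]_n) : 'rV[K]_m :=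
  \row_i (x *m Q i *m y^T) 0 0.

(** Rows of T are the new basis of the source, and G acts on values from the right:
    hence the transposes. *)
Lemma qmap_transform A (G : 'M[K]_m) (T : 'M[K]_n) :
  exists A', lmul_const G^T (comp_linear (qmap A) T^T) = qmap A' /\
   forall i k j, polar A' i k j = (bvec (polar A) (row k T) (row j T) *m G) 0 i.
Proof.
exists (fun i => \sum_l G l i *: (T *m A l *m T^T)); split.
  apply/colP => i; rewrite !mxE -qform_lin; apply: eq_bigr => l _.
  by rewrite !mxE qform_comp trmxK.
move=> i k j; rewrite /polar linear_sum /= -big_split /= summxE mxE.
apply: eq_bigr => l _; rewrite linearZ /= -scalerDr mxE [in RHS]mxE mulrC.
congr (_ * _); rewrite !trmx_mul trmxK mulmxA -mulmxDl -mulmxDr.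
by rewrite -row_mul mxE [RHS]mxE; apply: eq_bigr => p _; rewrite !mxE.
Qed.
End QuadraticMaps.

(** * Ranks, specialisation and points *)

Section RankTools.
Variable F : fieldType.

Lemma rank_minor m n (A : 'M[F]_(m, n)) :
  exists f g, \det (mxsub f g A : 'M_(\rank A)) != 0.
Proof.
have fullA1 : row_full (rowsub (maxrankfun A) A)^T.
  by rewrite /row_full mxrank_tr; apply: maxrowsub_free.
exists (maxrankfun A), (fullrankfun fullA1).
have -> : mxsub (maxrankfun A) (fullrankfun fullA1) A =
    (rowsub (fullrankfun fullA1) (rowsub (maxrankfun A) A)^T)^T.
  by apply/matrixP => i j; rewrite !mxE.
by rewrite det_tr -unitfE -unitmxE fullrowsub_unit.
Qed.

Lemma leq_rank_minor m n r (A : 'M[F]_(m, n)) (f : 'I_r -> 'I_m) (g : 'I_r -> 'I_n) :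
  \det (mxsub f g A) != 0 -> (r <= \rank A)%N.
Proof.
rewrite -unitfE -unitmxE => /mxrank_unit <-.
have -> : mxsub f g A = rowsub f (colsub g A) by apply/matrixP => i j; rewrite !mxE.
rewrite (leq_trans (mxrankS (rowsub_sub _ _))) //.
rewrite -mxrank_tr -[leqRHS]mxrank_tr.
have -> : (colsub g A)^T = rowsub g A^T by apply/matrixP => i j; rewrite !mxE.
exact: mxrankS (rowsub_sub _ _).
Qed.

Lemma rank_unit_rows_eq0 n N k (A : 'M[F]_(n, N)) : (\rank A <= k)%N ->
  exists2 T : 'M[F]_n, T \in unitmx & forall i : 'I_n, (k <= i)%N -> row i T *m A = 0.
Proof.
move=> rk; exists (invmx (col_ebase A)); first by rewrite unitmx_inv col_ebase_unit.
move=> i ki; rewrite -row_mul -{2}(mulmx_ebase A) -mulmxA mulKmx ?col_ebase_unit //.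
rewrite row_mul (_ : row i (pid_mx _) = 0) ?mul0mx //.
apply/rowP => j; rewrite !mxE [(i < _)%N]ltnNge (leq_trans rk ki) andbF //.
Qed.

Lemma row_free_normal k m (A : 'M[F]_(k, m)) : row_free A ->
  exists2 G : 'M[F]_m, G \in unitmx & A *m G = pid_mx k.
Proof.
move=> Af; have km : (k <= m)%N by rewrite -(eqP Af) rank_leq_col.
have [B AB] := row_freeP Af.
have E : A *m (B *m pid_mx k : 'M_m) = pid_mx k by rewrite mulmxA AB mul1mx.
have [|G Gu EG] := @complete_unitmx _ _ _ A (B *m pid_mx k).
  by rewrite E rank_pid_mx // (eqP Af).
by exists G; rewrite -?EG.
Qed.

(** The rows of E are a basis of a complement of the left kernel of A, and T
    completes it by a basis of that kernel. *)
Lemma adapted_basis n N k (A : 'M[F]_(n, N)) (E : 'M[F]_(k, n)) :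
  (\rank A <= k)%N -> row_free (E *m A) ->
  exists2 T : 'M[F]_n, T \in unitmx &
    (forall (i : 'I_n) (j : 'I_k), i = j :> nat -> row i T = row j E) /\
    (forall i : 'I_n, (k <= i)%N -> row i T *m A = 0).
Proof.
move=> rk Ef; have kn : (k <= n)%N.
  by rewrite -(eqP Ef) (leq_trans (mxrankM_maxr _ _)) // rank_leq_row.
have [T0 T0u T0A] := rank_unit_rows_eq0 rk.
pose T := \matrix_(i < n) (if insub (i : nat) is Some j then row (j : 'I_k) E else row i T0).
have T1 (i : 'I_n) (j : 'I_k) : i = j :> nat -> row i T = row j E.
  by move=> ij; rewrite rowK ij valK.
have T2 (i : 'I_n) : (k <= i)%N -> row i T = row i T0.
  by move=> ki; rewrite rowK insubF // ltnNge ki.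
exists T; last by split=> // i ki; rewrite T2 ?T0A.
rewrite -row_free_unit; apply/inj_row_free => z zT.
have zlow (j : 'I_k) : z 0 (widen_ord kn j) = 0.
  have : (\row_j z 0 (widen_ord kn j)) *m (E *m A) = 0.
    have zTA : z *m (T *m A) = 0 by rewrite mulmxA zT mul0mx.
    rewrite -[RHS]zTA mulmx_sum_row [RHS]mulmx_sum_row.
    rewrite [RHS](bigID (fun i : 'I_n => (i < k)%N)) /= [X in _ = _ + X]big1; last first.
      by move=> i; rewrite -leqNgt => ki; rewrite row_mul T2 // T0A // scaler0.
    rewrite addr0 (big_ord_narrow kn) /=; apply: eq_bigr => i _.
    by rewrite mxE !row_mul -(T1 (widen_ord kn i) i).
  move=> /(congr1 (mulmx^~ (pinvmx (E *m A)))); rewrite mul0mx mulmxKp // => /rowP/(_ j).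
  by rewrite !mxE.
suff : z *m T0 = 0.
  by move/(congr1 (mulmx^~ (invmx T0))); rewrite mulmxK // mul0mx.
rewrite -zT !mulmx_sum_row; apply: eq_bigr => i _.
have [ki|ik] := leqP k i; first by rewrite T2.
have := zlow (Ordinal ik); rewrite (_ : widen_ord _ _ = i); last exact: val_inj.
by move->; rewrite !scale0r.
Qed.
End RankTools.

(** A nonvanishing minor of the specialisation comes from a nonvanishing minor. *)
Lemma rank_specialize (R : idomainType) (F : fieldType) (phi : {rmorphism R -> F})
    m n (A : 'M[R]_(m, n)) :
  (\rank (map_mx phi A) <= \rank (map_mx (@tofrac R) A))%N.
Proof.
have [f [g]] := rank_minor (map_mx phi A).
rewrite -map_mxsub det_map_mx => d0; apply: (@leq_rank_minor _ _ _ _ _ f g).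
rewrite -map_mxsub det_map_mx tofrac_eq0.
by apply: contraNneq d0 => ->; rewrite rmorph0.
Qed.

Lemma fraction_quotient (R : idomainType) (x : {fraction R}) :
  exists2 d : R, d != 0 & exists r : R, tofrac d * x = tofrac r.
Proof.
exists (frac (repr x)).2; first exact: denom_ratioP.
exists (frac (repr x)).1; rewrite -{2}[x]reprK; unlock tofrac.
rewrite -[LHS]FracField.pi_mul; apply/eqmodP => /=; rewrite FracField.equivfE.
rewrite /FracField.mulf !numden_Ratio ?mulf_neq0 ?oner_neq0 ?denom_ratioP //.
by rewrite mulr1 mul1r.
Qed.

Lemma clear_denominators (R : idomainType) m n (A : 'M[{fraction R}]_(m, n)) :
  exists2 d : R, d != 0 & exists A' : 'M[R]_(m, n),
    map_mx (@tofrac R) A' = tofrac d *: A.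
Proof.
have [dn Hd Hn] := fin_all_exists2 (fun ij : 'I_m * 'I_n => fraction_quotient (A ij.1 ij.2)).
have [nm Hnm] := fin_all_exists Hn.
exists (\prod_ij dn ij); first by apply/prodf_neq0 => ij _; apply: Hd.
exists (\matrix_(i, j) ((\prod_(ij | ij != (i, j)) dn ij) * nm (i, j))).
apply/matrixP => i j; rewrite !mxE rmorphM /= -Hnm /=.
by rewrite [in RHS](bigD1 (i, j)) //= rmorphM /= mulrCA mulrA.
Qed.

Section Kronecker.

Lemma digits_inj N n (d d' : nat -> nat) :
  (forall i, (i < n)%N -> (d i < N)%N) -> (forall i, (i < n)%N -> (d' i < N)%N) ->
  (\sum_(i < n) d i * N ^ i = \sum_(i < n) d' i * N ^ i)%N ->
  forall i, (i < n)%N -> d i = d' i.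
Proof.
elim: n d d' => [//|n IH] d d' dN dN'.
rewrite !big_ord_recl !expn0 !muln1.
under eq_bigr do rewrite /bump /= expnS mulnCA.
under [in RHS]eq_bigr do rewrite /bump /= expnS mulnCA.
rewrite -!big_distrr /= ![(_ + N * _)%N]addnC ![(N * _)%N]mulnC => E.
have N0 : (0 < N)%N by apply: leq_ltn_trans (dN 0%N _).
have E0 : d 0%N = d' 0%N.
  by have := congr1 (modn^~ N) E; rewrite !modnMDl !modn_small ?dN ?dN'.
have ES : (\sum_(i < n) d i.+1 * N ^ i = \sum_(i < n) d' i.+1 * N ^ i)%N.
  by move: E; rewrite E0 => /addIn/eqP; rewrite eqn_pmul2r // => /eqP.
move=> [|i] // ilt; apply: (IH (fun j => d j.+1) (fun j => d' j.+1)) => // j jn.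
  exact: dN.
exact: dN'.
Qed.

(** Kronecker substitution: with x_i = X^(N^i) and N above the degree of f, distinct
    monomials of f become distinct powers of X. *)
Lemma mpoly_nonzero_value (K : fieldType) n (f : {mpoly K[n]}) : f != 0 ->
  exists v : 'I_n -> {poly K}, mmap (@polyC K) v f != 0.
Proof.
move=> f0; pose N := msize f; exists (fun i => 'X^(N ^ i)).
pose ex (m : 'X_{1..n}) := (\sum_(i < n) m i * N ^ i)%N.
have E : mmap (@polyC K) (fun i : 'I_n => 'X^(N ^ i)) f =
    \sum_(m <- msupp f) f@_m *: 'X^(ex m).
  rewrite /mmap; apply: eq_bigr => m _; rewrite mul_polyC; congr (_ *: _).
  rewrite /mmap1 /ex -prodrXr; apply: eq_bigr => i _.
  by rewrite -exprM mulnC.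
have [m0 m0f] : exists m, m \in msupp f.
  by exists (mlead f); apply: mlead_supp.
apply/eqP => /(congr1 (fun p : {poly K} => p`_(ex m0))).
rewrite E coef_sum coef0 (bigD1_seq m0) ?msupp_uniq //= big_seq_cond big1.
  by rewrite addr0 coefZ coefXn eqxx mulr1 => /eqP; rewrite mcoeff_eq0 m0f.
move=> m /andP[mf mm0]; rewrite coefZ coefXn; case: eqP => [Em|]; last by rewrite mulr0.
case/negP: mm0; apply/eqP/mnmP => i.
pose dg (m : 'X_{1..n}) j := if insub j is Some i then m (i : 'I_n) else 0%N.
have dgE (m' : 'X_{1..n}) (j : 'I_n) : dg m' j = m' j by rewrite /dg valK.
have lt (m' : 'X_{1..n}) j : m' \in msupp f -> (j < n)%N -> (dg m' j < N)%N.
  move=> m'f jn; rewrite -[j]/(nat_of_ord (Ordinal jn)) dgE.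
  apply: leq_ltn_trans (msize_mdeg_lt m'f); rewrite mdegE.
  by rewrite (bigD1 (Ordinal jn)) //= leq_addr.
rewrite -!dgE; apply: (@digits_inj N n) => // [j|j|]; try exact: lt.
move: Em; rewrite /ex => Em; rewrite (eq_bigr (fun i : 'I_n => (m i * N ^ i)%N)).
  by rewrite -Em; apply: eq_bigr => j _; rewrite dgE.
by move=> j _; rewrite dgE.
Qed.
End Kronecker.

(** * The net of a tuple of symmetric matrices *)

Lemma linear_rVE (F : fieldType) p (U : lmodType F) (phi : 'rV[F]_p -> U) :
  linear phi -> forall x, phi x = \sum_i x 0 i *: phi (delta_mx 0 i).
Proof.
move=> phiL x; have D a y z : phi (a *: y + z) = a *: phi y + phi z := phiL a y z.
have phi0 : phi 0 = 0.
  have := D 1 0 0; rewrite scaler0 addr0 scale1r => /eqP.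
  by rewrite -subr_eq subrr => /eqP.
have phiD y z : phi (y + z) = phi y + phi z by have := D 1 y z; rewrite !scale1r.
rewrite {1}(row_sum_delta x) (big_morph phi phiD phi0); apply: eq_bigr => i _.
by have := D (x 0 i) (delta_mx 0 i) 0; rewrite phi0 !addr0.
Qed.

Section ConcreteNet.
Variables (F : fieldType) (m n : nat) (Q : 'I_m -> 'M[F]_n).

Definition netf (h : 'rV[F]_m) (x y : 'rV[F]_n) : F :=
  \sum_i h 0 i * bvec Q x y 0 i.

Lemma bvecE x y i : bvec Q x y 0 i = (x *m Q i *m y^T) 0 0.
Proof. by rewrite mxE. Qed.

Lemma netf_is_net : (forall i, (Q i)^T = Q i) -> is_net netf.
Proof.
move=> Qsym; split.
- move=> h x y; apply: eq_bigr => i _; rewrite !bvecE.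
  congr (_ * _); transitivity ((x *m Q i *m y^T)^T 0 0); first by rewrite [RHS]mxE.
  by rewrite !trmx_mul trmxK Qsym mulmxA.
- move=> h h' x y; rewrite -big_split; apply: eq_bigr => i _.
  by rewrite mxE mulrDl.
- move=> c h x y; rewrite mulr_sumr; apply: eq_bigr => i _.
  by rewrite mxE mulrA.
- move=> h x x' y; rewrite -big_split; apply: eq_bigr => i _.
  by rewrite !bvecE !mulmxDl mxE mulrDr.
- move=> c h x y; rewrite mulr_sumr; apply: eq_bigr => i _.
  by rewrite !bvecE -!scalemxAl mxE mulrCA.
Qed.

Lemma netf_delta i x y : netf (delta_mx 0 i) x y = bvec Q x y 0 i.
Proof.
rewrite /netf (bigD1 i) //= big1 => [|j /negPf ji]; first by rewrite !mxE !eqxx mul1r addr0.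
by rewrite mxE ji andbF mul0r.
Qed.

Lemma netf_delta_entry i k j :
  netf (delta_mx 0 i) (delta_mx 0 k) (delta_mx 0 j) = Q i k j.
Proof.
rewrite netf_delta bvecE -rowE trmx_delta -colE.
by rewrite !mxE.
Qed.

(** For Q = [polar A] this is the Jacobian of [qmap A] at the point y. *)
Definition ptmx (y : 'rV[F]_n) : 'M[F]_(m, n) := \matrix_(i, j) (y *m Q i) 0 j.

Lemma netf_ptmx h y v : netf h y v = (h *m ptmx y *m v^T) 0 0.
Proof.
rewrite -mulmxA mxE; apply: eq_bigr => i _; congr (_ * _); rewrite !mxE.
by apply: eq_bigr => j _; rewrite !mxE.
Qed.

Lemma netf_bounded : (forall y, (\rank (ptmx y) <= 3)%N) -> bounded_rank3 netf.
Proof.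
move=> rk y h v; pose Hm := \matrix_(i < 4) h i; pose Vm := \matrix_(j < 4) v j.
have -> : \matrix_(i < 4, j < 4) netf (h i) y (v j) = Hm *m ptmx y *m Vm^T.
  apply/matrixP => i j; rewrite mxE netf_ptmx.
  rewrite -[in LHS](rowK (fun i : 'I_4 => h i) i) -[in LHS](rowK (fun j : 'I_4 => v j) j).
  rewrite -row_mul tr_row [LHS]mxE [RHS]mxE.
  by apply: eq_bigr => k _; rewrite !mxE.
apply/eqP; apply: contraT; rewrite -unitfE -unitmxE => /mxrank_unit r4.
have := leq_trans (mxrankM_maxl (Hm *m ptmx y) Vm^T)
  (leq_trans (mxrankM_maxr Hm (ptmx y)) (rk y)).
by rewrite r4.
Qed.

Lemma netf_frame e : \rank (ptmx e) = 3%N -> exists v1 v2 v3 h1 h2 h3,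
  frame netf e v1 v2 v3 h1 h2 h3.
Proof.
move=> rk; have [Hm [Vm HV]] : exists (Hm : 'M_(3, m)) (Vm : 'M_(n, 3)),
    Hm *m ptmx e *m Vm = 1%:M.
  have [L1 L1P] := row_fullP (col_base_full (ptmx e)).
  have [R1 R1P] := row_freeP (row_base_free (ptmx e)).
  rewrite -rk; exists L1, R1.
  transitivity (L1 *m (col_base (ptmx e) *m row_base (ptmx e)) *m R1).
    by rewrite mulmx_base.
  by rewrite mulmxA L1P mul1mx R1P.
have E i j : netf (row i Hm) e (col j Vm)^T = (i == j)%:R.
  rewrite netf_ptmx trmxK -row_mul.
  move/matrixP/(_ i j): HV; rewrite !mxE => <-.
  by apply: eq_bigr => k _; rewrite !mxE.
exists (col 0 Vm)^T, (col 1 Vm)^T, (col (inord 2) Vm)^T.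
exists (row 0 Hm), (row 1 Hm), (row (inord 2) Hm).
by split; rewrite E -val_eqE /= ?inordK.
Qed.

(** The matrix of x |-> (x *m A i)_i.  For A = Q its left kernel is the radical, so
    that its rank is the number of variables needed. *)
Definition stackmx (I : finType) (A : I -> 'M[F]_n) : 'M[F]_(n, #|{: I * 'I_n}|) :=
  \matrix_(k, c) A (enum_val c).1 k (enum_val c).2.

Lemma stackmxP (I : finType) (A : I -> 'M[F]_n) p (X : 'M[F]_(p, n)) :
  X *m stackmx A = 0 <-> forall i, X *m A i = 0.
Proof.
have E k i j : (X *m stackmx A) k (enum_rank (i, j)) = (X *m A i) k j.
  by rewrite !mxE; apply: eq_bigr => l _; rewrite !mxE enum_rankK.
split=> [X0 i|X0].
  by apply/matrixP => k j; rewrite -E X0 !mxE.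
apply/matrixP => k c; rewrite -[c]enum_valK; case: (enum_val c) => i j.
by rewrite E X0 !mxE.
Qed.

(** Its rank is the dimension of the span of the Q i, hence of the values of beta. *)
Definition spanmx : 'M[F]_(m, #|{: 'I_n * 'I_n}|) :=
  \matrix_(i, c) Q i (enum_val c).1 (enum_val c).2.

(** These matrices are the components of beta modulo the line spanned by w. *)
Definition wedge (w : 'rV[F]_m) (ab : 'I_m * 'I_m) : 'M[F]_n :=
  w 0 ab.1 *: Q ab.2 - w 0 ab.2 *: Q ab.1.

Lemma codim_le_rank N p (A : 'M[F]_(p, N)) k :
  codim_le k (fun x : 'rV[F]_p => x *m A = 0) -> (\rank A <= k)%N.
Proof.
move=> [phi phiL phi0]; pose P := \matrix_i phi (delta_mx 0 i).
have phiE x : phi x = x *m P.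
  rewrite (linear_rVE phiL) mulmx_sum_row.
  by apply: eq_bigr => i _; rewrite rowK.
have kk : (kermx P <= kermx A)%MS.
  apply/row_subP => i; apply/sub_kermxP/phi0; rewrite phiE.
  by rewrite -row_mul mulmx_ker row0.
have := mxrankS kk; rewrite !mxrank_ker => le1.
apply: leq_trans (rank_leq_col P).
by have := rank_leq_row A; have := rank_leq_row P; move: le1; lia.
Qed.

Lemma codim_le_weaken (X : lmodType F) k (S S' : X -> Prop) :
  (forall x, S x -> S' x) -> codim_le k S -> codim_le k S'.
Proof. by move=> SS [phi pL p0]; exists phi => // x /p0/SS. Qed.

Lemma small_span_rank : small_span netf -> (\rank spanmx <= 3)%N.
Proof.
move=> sp; apply: codim_le_rank; apply: codim_le_weaken sp => h h0.
apply/rowP => c; rewrite !mxE -[RHS](h0 (delta_mx 0 (enum_val c).1) (delta_mx 0 (enum_val c).2)).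
by apply: eq_bigr => i _; rewrite -netf_delta netf_delta_entry !mxE.
Qed.

Lemma netf_rad_mul x : (forall i, (Q i)^T = Q i) ->
  (forall h z, netf h z x = 0) -> forall i, x *m Q i = 0.
Proof.
move=> Qsym x0 i; apply/rowP => j; rewrite mxE.
have := x0 (delta_mx 0 i) (delta_mx 0 j); rewrite netf_delta bvecE -rowE => E.
rewrite mxE -[RHS]E mxE; apply: eq_bigr => k _.
by rewrite !mxE mulrC -{1}(Qsym i) mxE.
Qed.

Lemma small_radical_rank k : (forall i, (Q i)^T = Q i) ->
  small_radical netf k -> (\rank (stackmx Q) <= k)%N.
Proof.
move=> Qsym rd; apply: codim_le_rank; apply: codim_le_weaken rd => x x0.
by apply/stackmxP; apply: netf_rad_mul.
Qed.

(** The first alternative occurs when the vector w of the pencil is 0. *)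
Lemma pencil_rank k : (forall i, (Q i)^T = Q i) -> pencil netf k ->
  (\rank (stackmx Q) <= k)%N \/
  (exists2 w, w != 0 & (\rank (stackmx (wedge w)) <= k)%N).
Proof.
move=> Qsym [w wL cod].
pose ww := \row_i w (delta_mx 0 i).
have netB := netf_is_net Qsym.
have wE h : w h = \sum_i h 0 i * ww 0 i.
  rewrite (linear_rVE (U := F^o) (phi := w) wL).
  by apply: eq_bigr => i _; rewrite mxE.
have [w0|w0] := eqVneq ww 0.
  left; apply: codim_le_rank; apply: codim_le_weaken cod => x x0.
  apply/stackmxP; apply: netf_rad_mul => // h z; apply: x0.
  by rewrite wE w0 big1 // => i _; rewrite mxE mulr0.
right; exists ww => //; apply: codim_le_rank; apply: codim_le_weaken cod => x x0.
apply/stackmxP => -[a b]; apply/rowP => j; rewrite [RHS]mxE.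
have w_ab : w (ww 0 a *: delta_mx 0 b - ww 0 b *: delta_mx 0 a) = 0.
  rewrite wE (eq_bigr (fun i => (i == b)%:R * (ww 0 a * ww 0 i)
                              - (i == a)%:R * (ww 0 b * ww 0 i))); last first.
    by move=> i _; rewrite !mxE !eqxx /=; ring.
  have pick c (f : 'I_m -> F) : \sum_i (i == c)%:R * f i = f c.
    rewrite (bigD1 c) //= eqxx mul1r big1 ?addr0 // => i /negPf ->.
    by rewrite mul0r.
  by rewrite sumrB (pick b) (pick a) mulrC subrr.
have := x0 _ (delta_mx 0 j) w_ab.
rewrite !(netE netB) !netf_delta !bvecE => E.
have sw i : ((delta_mx 0 j : 'rV[F]_n) *m Q i *m x^T) 0 0 = (x *m Q i) 0 j.
  transitivity ((x *m Q i *m (delta_mx 0 j : 'rV[F]_n)^T) 0 0).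
    rewrite -!bvecE -!netf_delta; exact: (net_sym netB).
  by rewrite trmx_delta -colE mxE.
rewrite !sw in E; rewrite /wedge /= mulmxBr -!scalemxAr.
by rewrite mxE [X in X + _]mxE [X in _ + X]mxE [X in - X]mxE.
Qed.
End ConcreteNet.

(** * Descent from K(t) to K *)

Lemma tofrac_mx0 (R : idomainType) m n (A : 'M[R]_(m, n)) :
  map_mx (@tofrac R) A = 0 -> A = 0.
Proof.
move=> /matrixP A0; apply/matrixP => i j; apply/eqP.
by have /eqP := A0 i j; rewrite !mxE tofrac_eq0.
Qed.

Lemma rank_scale_eq (F : fieldType) m n (a b : F) (A B : 'M[F]_(m, n)) :
  a != 0 -> b != 0 -> a *: A = b *: B -> \rank A = \rank B.
Proof. by move=> a0 b0 E; rewrite -(eqmx_scale A a0) E eqmx_scale. Qed.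

Section Specialization.
Variable K : fieldType.
Local Notation L := {fraction {poly K}}.

Definition const_frac : K -> L := @tofrac {poly K} \o @polyC K.
HB.instance Definition _ := GRing.RMorphism.on const_frac.

Lemma infinite_ratfrac : infinite_field L.
Proof.
move=> p p0; have [//|pn0] := eqVneq p 0.
pose rs := [seq tofrac ('X^i : {poly K}) | i <- iota 0 (size p)].
have rsu : uniq rs.
  rewrite map_inj_uniq ?iota_uniq // => i j /eqP; rewrite tofrac_eq => /eqP.
  by move/(congr1 (fun q : {poly K} => size q)); rewrite !size_polyXn => -[].
have rsr : all (root p) rs by apply/allP => t _; rewrite rootE p0.
by have := max_poly_roots pn0 rsr rsu; rewrite size_map size_iota ltnn.
Qed.

Lemma factor_Xn m (w : 'rV[{poly K}]_m) : w != 0 -> exists r (w' : 'rV[{poly K}]_m),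
  w = 'X^r *: w' /\ map_mx (horner_eval 0) w' != 0.
Proof.
move=> w0; have [i wi] : exists i, w 0 i != 0.
  apply/existsP; apply: contraT; rewrite negb_exists => /forallP w0'.
  by case/negP: w0; apply/eqP/rowP => i; rewrite mxE; apply/eqP; have := w0' i; rewrite negbK.
move: {w0} w wi; suff H N (w : 'rV[{poly K}]_m) : (size (w 0%R i) <= N)%N -> w 0 i != 0 ->
    exists r (w' : 'rV[{poly K}]_m), w = 'X^r *: w' /\ map_mx (horner_eval 0) w' != 0.
  by move=> w; apply: (H _ w (leqnn _)).
elim: N w => [|N IH] w; first by rewrite leqn0 size_poly_eq0 => ->.
move=> sw wi; have [E0|E0] := eqVneq (map_mx (horner_eval 0) w) 0; last first.
  by exists 0%N, w; rewrite expr0 scale1r.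
have dv j : w 0 j = (w 0 j %/ 'X) * 'X.
  rewrite divpK // -['X]subr0 dvdp_XsubCl rootE.
  by have /rowP/(_ j) := E0; rewrite !mxE /horner_eval => ->.
have wi' : w 0 i %/ 'X != 0 by apply: contraNneq wi => q0; rewrite dv q0 mul0r.
have [||r [w' [Ew w'0]]] := IH (\row_j (w 0 j %/ 'X)); rewrite ?mxE //.
  by move: sw; rewrite {1}dv size_mulX.
exists r.+1, w'; split=> //; apply/rowP => j.
have /rowP/(_ j) := Ew; rewrite !mxE => Ej.
by rewrite dv Ej exprS; ring.
Qed.

Variables (m n : nat) (Q : 'I_m -> 'M[K]_n).
Let QL i := map_mx const_frac (Q i).

Lemma span_descent : (\rank (spanmx QL) <= 3)%N -> (\rank (spanmx Q) <= 3)%N.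
Proof.
have -> : spanmx QL = map_mx const_frac (spanmx Q) by apply/matrixP => i c; rewrite !mxE.
by rewrite mxrank_map.
Qed.

Lemma map_stackmx : stackmx QL = map_mx const_frac (stackmx Q).
Proof. by apply/matrixP => i c; rewrite !mxE. Qed.

(** A vector spanning the line is chosen with polynomial entries that do not all
    vanish at 0; then the rank can only drop under evaluation at 0. *)
Lemma pencil_descent k (w : 'rV[L]_m) : w != 0 ->
  (\rank (stackmx (wedge QL w)) <= k)%N ->
  exists2 w0 : 'rV[K]_m, w0 != 0 & (\rank (stackmx (wedge Q w0)) <= k)%N.
Proof.
move=> w0 rk; have [d d0 [w1 Ew1]] := clear_denominators w.
have w1n0 : w1 != 0.
  apply: contraNneq w0 => E; move: Ew1; rewrite E map_mx0 => /esym/eqP.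
  by rewrite scaler_eq0 tofrac_eq0 (negPf d0).
have [r [w2 [Ew2 w2n0]]] := factor_Xn w1n0.
exists (map_mx (horner_eval 0) w2) => //.
pose P := \matrix_(k < n, c < #|{: ('I_m * 'I_m) * 'I_n}|)
  (w2 0 (enum_val c).1.1 * (Q (enum_val c).1.2 k (enum_val c).2)%:P
   - w2 0 (enum_val c).1.2 * (Q (enum_val c).1.1 k (enum_val c).2)%:P).
have -> : stackmx (wedge Q (map_mx (horner_eval 0) w2)) = map_mx (horner_eval 0) P.
  by apply/matrixP => i c; rewrite !mxE /horner_eval !hornerE.
apply: leq_trans (rank_specialize _ _) _; apply: leq_trans rk.
have Xr0 : tofrac ('X^r : {poly K}) != 0 by rewrite tofrac_eq0 -size_poly_eq0 size_polyXn.
have E : tofrac 'X^r *: map_mx (@tofrac {poly K}) P = tofrac d *: stackmx (wedge QL w).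
  apply/matrixP => i c; rewrite !mxE rmorphB !rmorphM /= /const_frac /=.
  have Ew j : tofrac 'X^r * tofrac (w2 0 j) = tofrac d * w 0 j.
    by have /rowP/(_ j) := Ew1; rewrite Ew2 !mxE rmorphM.
  by rewrite mulrBr !mulrA !Ew; ring.
have dn0 : tofrac d != 0 by rewrite tofrac_eq0.
by rewrite (rank_scale_eq Xr0 dn0 E).
Qed.

(** Skewness is linear with coefficients in K, so that it holds coefficient by
    coefficient once the denominators are cleared. *)
Lemma skew_descent (JL : 'M[L]_n) i0 :
  (forall i, JL *m QL i + QL i *m JL^T = 0) -> JL *m QL i0 != 0 ->
  exists2 J : 'M[K]_n, forall i, J *m Q i + Q i *m J^T = 0 & J *m Q i0 != 0.
Proof.
move=> skew nz; have [d d0 [JP EJ]] := clear_denominators JL.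
pose QP i := map_mx (@polyC K) (Q i).
have QLE i : QL i = map_mx (@tofrac {poly K}) (QP i).
  by apply/matrixP => a b; rewrite !mxE.
have skewP i : JP *m QP i + QP i *m JP^T = 0.
  apply: tofrac_mx0; rewrite map_mxD !map_mxM.
  rewrite -matrix.map_trmx EJ -QLE linearZ /= -scalemxAl -scalemxAr -scalerDr.
  by rewrite skew scaler0.
have nzP : JP *m QP i0 != 0.
  apply: contraNneq nz => E.
  have : tofrac d *: (JL *m QL i0) = 0.
    by rewrite scalemxAl -EJ QLE -map_mxM E map_mx0.
  by move/eqP; rewrite scaler_eq0 tofrac_eq0 (negPf d0).
have [a [b /eqP ab]] := matrix0Pn _ nzP.
have [k abk] : exists k, ((JP *m QP i0) a b)`_k != 0.
  by exists (size ((JP *m QP i0) a b)).-1; rewrite -lead_coefE lead_coef_eq0; apply/eqP.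
have coefM i x y : ((JP *m QP i) x y)`_k = (map_mx (coefp k) JP *m Q i) x y.
  by rewrite !mxE coef_sum; apply: eq_bigr => l _; rewrite !mxE coefMC.
exists (map_mx (coefp k) JP); last first.
  by apply/matrix0Pn; exists a, b; rewrite -coefM.
move=> i; apply/matrixP => x y.
have Pxy : (JP *m QP i) x y + (QP i *m JP^T) x y = 0.
  by have /matrixP/(_ x y) := skewP i; rewrite mxE [RHS]mxE.
rewrite mxE [RHS]mxE -coefM -[RHS](coef0 _ k) -Pxy coefD; congr (_ + _).
by rewrite !mxE coef_sum; apply: eq_bigr => l _; rewrite !mxE coefCM.
Qed.
End Specialization.

Section TwistedDescent.
Variables (K L : fieldType) (iota : {rmorphism K -> L}) (m n : nat).
Variable Q : 'I_m -> 'M[K]_n.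
Hypothesis Qsym : forall i, (Q i)^T = Q i.
Let QL i := map_mx iota (Q i).
Hypotheses (two0 : 2%:R != 0 :> L) (Linf : infinite_field L).

Lemma map_sym i : (QL i)^T = QL i.
Proof. by rewrite /QL matrix.map_trmx Qsym. Qed.

Let netB := netf_is_net map_sym.

Lemma skew_netf (J : 'M[L]_n) : (forall i, J *m QL i + QL i *m J^T = 0) ->
  forall h x y, netf QL h (x *m J) y + netf QL h x (y *m J) = 0.
Proof.
move=> sk h x y; rewrite -big_split /= big1 // => i _.
rewrite -mulrDr !bvecE trmx_mul.
transitivity (h 0 i * (x *m (J *m QL i + QL i *m J^T) *m y^T) 0 0).
  by congr (_ * _); rewrite mulmxDr mulmxDl [RHS]mxE !mulmxA.
by rewrite sk mulmx0 mul0mx mxE mulr0.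
Qed.

Lemma netf_mx_eq0 (M : 'M[L]_n) i :
  (forall x y, netf QL (delta_mx 0 i) (x *m M) y = 0) -> M *m QL i = 0.
Proof.
move=> M0; apply/matrixP => a b; rewrite [RHS]mxE.
have := M0 (delta_mx 0 a) (delta_mx 0 b); rewrite netf_delta bvecE trmx_delta -colE.
by rewrite -mulmxA -rowE !mxE.
Qed.

Lemma twisted_matrix : twisted (netf QL) -> exists (e : 'rV[L]_n) (J : 'M[L]_n) (c : L),
  [/\ c != 0, exists h, netf QL h e e != 0,
      forall i, J *m QL i + QL i *m J^T = 0 &
      forall i, J *m J *m QL i = - c *: QL i] /\
  (forall x, (forall h, netf QL h e x = 0) ->
        exists a, forall h z, netf QL h z (x - a *: (e *m J)) = 0).
Proof.
move=> [e [J [c [[JL c0 he skew sq] [ke _]]]]].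
pose JM := \matrix_i J (delta_mx 0 i).
have JE x : J x = x *m JM.
  rewrite (linear_rVE JL) mulmx_sum_row.
  by apply: eq_bigr => i _; rewrite rowK.
exists e, JM, c; split; last by move=> x /ke[a Ha]; exists a => h z; rewrite -JE.
have pt i x y : netf QL (delta_mx 0 i) x y = (x *m QL i *m y^T) 0 0.
  by rewrite netf_delta bvecE.
split=> // i; apply/matrixP => a b; rewrite [RHS]mxE.
  have := skew (delta_mx 0 i) (delta_mx 0 a) (delta_mx 0 b).
  rewrite !JE !pt trmx_mul !trmx_delta -!mulmxA -!rowE.
  by rewrite !mulmxA -!colE !mxE.
have := sq (delta_mx 0 i) (delta_mx 0 a) (delta_mx 0 b).
rewrite !JE !pt trmx_delta -!colE -!mulmxA -!rowE.
by rewrite !mulmxA !mxE.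
Qed.

(** As N is skew, beta(x, x N) = 0, so that e N lies in the kernel of beta(e, -), a
    line modulo the radical.  Subtracting a multiple of J from N leaves a skew M with
    e M = 0.  Then every y M lies in that kernel, y M = a(y) e J, and
    0 = beta(y, y M) = a(y) beta(y, e J) forces M = 0, always modulo the radical. *)
Lemma skew_unique (e : 'rV[L]_n) (J N : 'M[L]_n) :
  (exists h, netf QL h e e != 0) -> (exists i, e *m J *m QL i != 0) ->
  (forall x, (forall h, netf QL h e x = 0) ->
        exists a, forall h z, netf QL h z (x - a *: (e *m J)) = 0) ->
  (forall i, J *m QL i + QL i *m J^T = 0) ->
  (forall i, N *m QL i + QL i *m N^T = 0) ->
  exists lam, forall i, N *m QL i = lam *: (J *m QL i).
Proof.
move=> [h0 he] [i0 eJ] ke skJ skN.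
have two_eq0 := double_eq0 two0.
have iso (M : 'M[L]_n) : (forall i, M *m QL i + QL i *m M^T = 0) ->
    forall h x, netf QL h x (x *m M) = 0.
  move=> sk h x; apply: two_eq0.
  by have := skew_netf sk h x x; rewrite {1}(net_sym netB).
have [lam Hlam] := ke (e *m N) (fun h => iso N skN h e).
exists lam; pose M := N - lam *: J.
have skM i : M *m QL i + QL i *m M^T = 0.
  rewrite /M mulmxBl linearB /= mulmxBr addrACA -opprD skN -scalemxAl.
  by rewrite linearZ /= -scalemxAr -scalerDr skJ scaler0 subrr.
have eM h z : netf QL h z (e *m M) = 0.
  by rewrite /M mulmxBr -scalemxAr Hlam.
have MM y : exists a, forall h z, netf QL h z (y *m M) = a * netf QL h z (e *m J).
  have [|a Ha] := ke (y *m M).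
    by move=> k; have := skew_netf skM k e y; rewrite (net_sym netB) eM add0r.
  exists a => k z; have := Ha k z; rewrite !(netE netB) => /eqP.
  by rewrite subr_eq0 => /eqP.
move=> i; apply/eqP; rewrite -subr_eq0 scalemxAl -mulmxBl -/M; apply/eqP.
apply: netf_mx_eq0 => x y; rewrite (net_sym netB); move: x.
have [||||g0] := @scalar_avoid2 _ _ Linf (fun x => netf QL (delta_mx 0 i) y (x *m M))
   (fun x => netf QL (delta_mx 0 i0) x (e *m J)).
- by move=> a x z; rewrite mulmxDl -scalemxAl !(netE netB).
- exact: scalar_net_l.
- move=> x; have [a Ha] := MM x; rewrite Ha mulrAC.
  by rewrite -Ha (iso M skM) mul0r.
- by [].
case/negP: eJ; apply/eqP/rowP => j; rewrite [RHS]mxE.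
have := g0 (delta_mx 0 j); rewrite (net_sym netB) netf_delta bvecE trmx_delta -colE.
by rewrite !mxE.
Qed.

(** J is a multiple of the given operator over L modulo the radical, so that its
    square is a scalar of L; the scalar is a quotient of matrix entries in K. *)
Lemma twisted_descent (J : 'M[K]_n) i0 : twisted (netf QL) ->
  (forall i, J *m Q i + Q i *m J^T = 0) -> J *m Q i0 != 0 ->
  exists2 c : K, c != 0 & forall i, J *m J *m Q i = - c *: Q i.
Proof.
move=> /twisted_matrix[e [JL [c [[c0 he skJ sq] ke]]]] sk nz.
pose JK := map_mx iota J.
have skK i : JK *m QL i + QL i *m JK^T = 0.
  by rewrite matrix.map_trmx -!map_mxM -map_mxD sk map_mx0.
have eJ : exists i, e *m JL *m QL i != 0.
  have [h hee] := he; apply: NNPP => nx.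
  have eJ0 i : e *m JL *m QL i = 0.
    by apply/eqP; apply: contraT => ne; case: nx; exists i.
  case/negP: hee; rewrite /netf big1 // => i _; rewrite bvecE.
  have E : e *m QL i = 0.
    have : (- c) *: (e *m QL i) = 0.
      rewrite scalemxAr -sq !mulmxA.
      have -> : e *m JL *m JL *m QL i = - (e *m JL *m QL i *m JL^T).
        have := skJ i => /eqP; rewrite addr_eq0 => /eqP E.
        by rewrite -mulmxA E mulmxN !mulmxA.
      by rewrite eJ0 mul0mx oppr0.
    by move/eqP; rewrite scaler_eq0 oppr_eq0 (negPf c0) => /eqP.
  by rewrite E mul0mx mxE mulr0.
have [lam Hlam] := skew_unique he eJ ke skJ skK.
have lam0 : lam != 0.
  apply: contraNneq nz => l0; have := Hlam i0; rewrite l0 scale0r /JK /QL -map_mxM.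
  by move=> /eqP; rewrite map_mx_eq0.
have sqK i : JK *m JK *m QL i = - (lam ^+ 2 * c) *: QL i.
  have sJ k : QL k *m JL^T = - (JL *m QL k).
    by apply/eqP; rewrite -addr_eq0 addrC skJ.
  have sK k : QL k *m JK^T = - (JK *m QL k).
    by apply/eqP; rewrite -addr_eq0 addrC skK.
  rewrite -mulmxA Hlam -scalemxAr.
  have -> : JK *m (JL *m QL i) = lam *: (JL *m JL *m QL i).
    have -> : JL *m QL i = - (QL i *m JL^T) by rewrite sJ opprK.
    rewrite mulmxN mulmxA Hlam -scalemxAl -scalerN; congr (_ *: _).
    by rewrite -(mulmxA JL (QL i)) sJ mulmxN opprK mulmxA.
  by rewrite sq !scalerA; congr (_ *: _); ring.
have [x [y xy]] : exists x y, Q i0 x y != 0.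
  by apply/matrix0Pn; apply: contraNneq nz => ->; rewrite mulmx0.
pose cK := - ((J *m J *m Q i0) x y / Q i0 x y).
have EcK : iota cK = lam ^+ 2 * c.
  have /matrixP/(_ x y) := sqK i0; rewrite -!map_mxM [LHS]mxE [RHS]mxE [QL i0 x y]mxE => E.
  rewrite /cK rmorphN fmorph_div E; field.
  by rewrite fmorph_eq0.
exists cK.
  by rewrite -(fmorph_eq0 iota) EcK mulf_neq0 ?expf_neq0.
move=> i; apply: (map_mx_inj (f := iota)).
by rewrite !map_mxM sqK -EcK map_mxZ [in RHS]rmorphN.

Qed.
End TwistedDescent.

(** * The classification over K *)

Section GenericPoint.
Variables (K : fieldType) (m n : nat) (A : 'I_m -> 'M[K]_n).
Local Notation L := {fraction {poly K}}.
Local Notation iota := (@const_frac K).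
Let Q := polar A.
Let QL i := map_mx iota (Q i).
Let H := qmap A.

Definition evalL (y : 'rV[L]_n) : {mpoly K[n]} -> L := mmap iota (fun i => y 0 i).
HB.instance Definition _ y := GRing.RMorphism.on (evalL y).

Lemma evalL_jacobian y : map_mx (evalL y) (jacobian H) = ptmx QL y.
Proof.
apply/matrixP => i j; rewrite mxE jacobian_qmap rmorph_sum /= !mxE.
by apply: eq_bigr => k _; rewrite /evalL mmapZ mmapX mmap1U mulrC !mxE.
Qed.

Lemma evalL_qform y (M : 'M[K]_n) :
  evalL y (qform M) = (y *m map_mx iota M *m y^T) 0 0.
Proof.
rewrite /qform rmorph_sum /= mxE.
under eq_bigr do rewrite rmorph_sum /=.
rewrite exchange_big; apply: eq_bigr => j _; rewrite !mxE mulr_suml.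
apply: eq_bigr => k _; rewrite /evalL mmapZ /= rmorphM /= !mmapX !mmap1U !mxE.
by ring.
Qed.

Lemma evalLZ y c p : evalL y (c *: p) = iota c * evalL y p.
Proof. exact: mmapZ. Qed.

Lemma evalL_value (v : 'I_n -> {poly K}) p :
  evalL (\row_i tofrac (v i)) p = tofrac (mmap (@polyC K) v p).
Proof.
rewrite /evalL /mmap rmorph_sum; apply: eq_bigr => s _.
rewrite rmorphM /mmap1 rmorph_prod; congr (_ * _); apply: eq_bigr => i _.
by rewrite mxE rmorphXn.
Qed.

Hypothesis rk3 : rk (jacobian H) = 3%N.

Lemma ptmx_rank y : (\rank (ptmx QL y) <= 3)%N.
Proof. by rewrite -evalL_jacobian -rk3 /rk; exact: rank_specialize. Qed.

Lemma generic_point (p : {mpoly K[n]}) : p != 0 ->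
  exists2 e, \rank (ptmx QL e) = 3%N & evalL e p != 0.
Proof.
move=> p0; have [f [g]] := rank_minor (map_mx (@tofrac {mpoly K[n]}) (jacobian H)).
rewrite -map_mxsub det_map_mx tofrac_eq0 => d0.
have [v] := mpoly_nonzero_value (mulf_neq0 d0 p0).
rewrite -(tofrac_eq0) -evalL_value rmorphM mulf_eq0 negb_or => /andP[de pe].
move: (\row_i _) de pe => e de pe; exists e => //; apply/eqP; rewrite eqn_leq ptmx_rank /=.
rewrite -{1}rk3 /rk; apply: (@leq_rank_minor _ _ _ _ _ f g).
rewrite -evalL_jacobian -map_mxsub det_map_mx; exact: de.
Qed.

Lemma polar_sym i : (Q i)^T = Q i.
Proof. by rewrite /Q /polar linearD /= trmxK addrC. Qed.

Lemma polarL_sym i : (QL i)^T = QL i.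
Proof. by rewrite /QL matrix.map_trmx polar_sym. Qed.

Definition odd_types := [\/ (\rank (spanmx Q) <= 3)%N, (\rank (stackmx Q) <= 3)%N,
    exists2 w : 'rV[K]_m, w != 0 & (\rank (stackmx (wedge Q w)) <= 2)%N |
    exists (J : 'M[K]_n) (c : K), [/\ c != 0, (\rank (stackmx Q) <= 4)%N,
      forall i, J *m Q i + Q i *m J^T = 0 &
      forall i, J *m J *m Q i = - c *: Q i] ].

Lemma stack_descent k : (\rank (stackmx QL) <= k)%N -> (\rank (stackmx Q) <= k)%N.
Proof. by rewrite map_stackmx mxrank_map. Qed.

Theorem odd_rank3 : 2%:R != 0 :> K -> odd_types.
Proof.
move=> two0; have twoL : 2%:R != 0 :> L.
  by rewrite -(rmorph_nat (@const_frac K)) fmorph_eq0.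
have [i Hi] : exists i, qform (A i) != 0.
  apply: NNPP => nx; have J0 : jacobian H = 0.
    apply/matrixP => i j; rewrite !mxE; have -> : qform (A i) = 0.
      by apply/eqP; apply: contraT => ne; case: nx; exists i.
    by rewrite mderiv0.
  by move: rk3; rewrite /rk J0 map_mx0 mxrank0.
have [e re pe] := generic_point Hi.
have netB := netf_is_net polarL_sym.
have bd := netf_bounded ptmx_rank.
have [v1 [v2 [v3 [h1 [h2 [h3 F]]]]]] := netf_frame re.
have he : netf QL (delta_mx 0 i) e e != 0.
  rewrite netf_delta bvecE -evalL_qform.
  have -> : qform (Q i) = 2%:R *: qform (A i).
    by rewrite (euler_qform (A i) two0) scalerA mulfV // scale1r.
  have c0 : iota 2%:R != 0 by rewrite fmorph_eq0.
  rewrite evalLZ; exact: mulf_neq0 c0 pe.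
have [sp|rd|pn|tw] := odd_classification netB (@infinite_ratfrac K) bd twoL F he.
- by constructor 1; apply: span_descent; apply: small_span_rank sp.
- by constructor 2; apply: stack_descent; apply: small_radical_rank polarL_sym rd.
- have [r2|[w w0 rw]] := pencil_rank polarL_sym pn.
    by constructor 2; apply: leq_trans (stack_descent r2) _.
  by constructor 3; apply: pencil_descent w0 rw.
- constructor 4; have r4 : (\rank (stackmx QL) <= 4)%N.
    case: (tw) => e' [J' [c' [_ [_ r4]]]].
    exact: small_radical_rank polarL_sym r4.
  have [e' [JL [c [[c0 _ skJ sq] _]]]] := twisted_matrix (iota := @const_frac K) (Q := Q) tw.
  have nz : JL *m QL i != 0.
    apply: contraNneq he => E; rewrite netf_delta bvecE.
    have : - c *: QL i = 0 by rewrite -sq -mulmxA E mulmx0.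
    move/eqP; rewrite scaler_eq0 oppr_eq0 (negPf c0) => /eqP ->.
    by rewrite mulmx0 mul0mx mxE.
  have [J sk nzJ] := skew_descent skJ nz.
  have [cK cK0 sqK] := twisted_descent polar_sym twoL (@infinite_ratfrac K) tw sk nzJ.
  by exists J, cK; split=> //; apply: stack_descent.
Qed.

Definition even_types := [\/ (\rank (spanmx Q) <= 3)%N, (\rank (stackmx Q) <= 4)%N |
    exists2 w : 'rV[K]_m, w != 0 & (\rank (stackmx (wedge Q w)) <= 3)%N].

Theorem even_rank3 : 2%:R = 0 :> K -> even_types.
Proof.
move=> two0.
have twoL (x : L) : x + x = 0.
  have E : 2%:R = 0 :> L by rewrite -(rmorph_nat (@const_frac K)) two0 rmorph0.
  by rewrite -mulr2n -mulr_natl E mul0r.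
have [e re _] := generic_point (oner_neq0 _).
have netB := netf_is_net polarL_sym.
have bd := netf_bounded ptmx_rank.
have [v1 [v2 [v3 [h1 [h2 [h3 F]]]]]] := netf_frame re.
have alt h x : netf QL h x x = 0.
  rewrite /netf big1 // => i _; rewrite bvecE -evalL_qform.
  have -> : qform (Q i) = 0; last by rewrite [evalL _ _]rmorph0 mulr0.
  have E2 (p : {mpoly K[n]}) : p + p = 0.
    by rewrite -mulr2n -scaler_nat two0 scale0r.
  by rewrite /Q /polar -qformD qform_tr E2.
have [sp|rd|pn] := even_classification netB (@infinite_ratfrac K) bd twoL alt F.
- by constructor 1; apply: span_descent; apply: small_span_rank sp.
- by constructor 2; apply: stack_descent; apply: small_radical_rank polarL_sym rd.
- have [r3|[w w0 rw]] := pencil_rank polarL_sym pn.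
    by constructor 2; apply: leq_trans (stack_descent r3) _.
  by constructor 3; apply: pencil_descent w0 rw.
Qed.
End GenericPoint.

(** * Construction of the normal forms *)

Section NormalForms.
Variables (K : fieldType) (m n : nat) (A : 'I_m -> 'M[K]_n).
Let Q := polar A.
Let H := qmap A.
Let Qsym i : (Q i)^T = Q i := polar_sym A i.

Lemma jacobian_row0 (B : 'I_m -> 'M[K]_n) i : polar B i = 0 -> row i (jacobian (qmap B)) = 0.
Proof.
move=> B0; apply/rowP => j; rewrite mxE jacobian_qmap B0 mxE big1 // => k _.
by rewrite mxE scale0r.
Qed.

Lemma jacobian_col0 (B : 'I_m -> 'M[K]_n) j :
  (forall i k, polar B i k j = 0) -> col j (jacobian (qmap B)) = 0.
Proof.
move=> B0; apply/colP => i; rewrite mxE jacobian_qmap mxE big1 // => k _.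
by rewrite B0 scale0r.
Qed.

Definition equivalent_to (P : polymap K m n -> Prop) := exists (S : 'M[K]_m) (T : 'M[K]_n),
  [/\ S \in unitmx, T \in unitmx & P (lmul_const S (comp_linear H T))].

Lemma span_form1 : (\rank (spanmx Q) <= 3)%N -> equivalent_to (@form1 K m n).
Proof.
move=> rk; have [G Gu G0] := rank_unit_rows_eq0 rk.
exists G, 1%:M; split=> //; first exact: unitmx1.
have [A' [EA' pA']] := qmap_transform A G^T 1%:M.
rewrite trmxK trmx1 in EA'; rewrite EA' => i i3; apply: jacobian_row0.
apply/matrixP => k j; rewrite pA' [RHS]mxE.
have /rowP/(_ (enum_rank (k, j))) := G0 i i3; rewrite [RHS]mxE => <-.
rewrite !mxE; apply: eq_bigr => l _.
rewrite -netf_delta !row1 netf_delta_entry !mxE enum_rankK mulrC //.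
Qed.

Lemma bvec0l x y : (forall i, x *m Q i = 0) -> bvec Q x y = 0.
Proof. by move=> x0; apply/rowP => i; rewrite bvecE x0 mul0mx !mxE. Qed.

Lemma bvecC x y : bvec Q x y = bvec Q y x.
Proof.
by apply/rowP => i; rewrite -!netf_delta (net_sym (netf_is_net Qsym)).
Qed.

Lemma bvecDl x x' y : bvec Q (x + x') y = bvec Q x y + bvec Q x' y.
Proof.
apply/rowP => i; rewrite [RHS]mxE -!netf_delta.
exact: (net_addl (netf_is_net Qsym)).
Qed.

Lemma bvecZl c x y : bvec Q (c *: x) y = c *: bvec Q x y.
Proof.
apply/rowP => i; rewrite [RHS]mxE -!netf_delta.
exact: (net_scalel (netf_is_net Qsym)).
Qed.

Lemma bvecDr x y y' : bvec Q x (y + y') = bvec Q x y + bvec Q x y'.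
Proof. by rewrite bvecC bvecDl !(bvecC x). Qed.

Lemma bvecZr c x y : bvec Q x (c *: y) = c *: bvec Q x y.
Proof. by rewrite bvecC bvecZl (bvecC x). Qed.

Lemma small_stack_first_cols k : (\rank (stackmx Q) <= k)%N ->
  equivalent_to (fun Ht => only_first_cols k (jacobian Ht)).
Proof.
move=> rk; have [T Tu T0] := rank_unit_rows_eq0 rk.
exists 1%:M, T^T; split; rewrite ?unitmx1 ?unitmx_tr //.
have [A' [EA' pA']] := qmap_transform A 1%:M T.
rewrite trmx1 in EA'; rewrite EA' => j kj; apply: jacobian_col0 => i a.
rewrite pA' bvecC bvec0l ?mul0mx ?mxE //.
by apply/stackmxP; apply: T0.
Qed.

Lemma bvec_span N (W : 'M[K]_(N, m)) (T : 'M[K]_n) : T \in unitmx ->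
  (forall a b, (bvec Q (row a T) (row b T) <= W)%MS) ->
  forall x y, (bvec Q x y <= W)%MS.
Proof.
move=> Tu TW x y.
have decomp z : z = \sum_a (z *m invmx T) 0 a *: row a T.
  by rewrite -mulmx_sum_row mulmxKV.
have step z : (forall b, (bvec Q z (row b T) <= W)%MS) -> (bvec Q z y <= W)%MS.
  move=> zW; rewrite (decomp y); elim/big_ind: _ => [|u v Hu Hv|b _].
  - by rewrite bvecC bvec0l ?sub0mx // => i; rewrite mul0mx.
  - by rewrite bvecDr addmx_sub.
  - by rewrite bvecZr scalemx_sub.
apply: step => b; rewrite (decomp x); elim/big_ind: _ => [|u v Hu Hv|a _].
- by rewrite bvec0l ?sub0mx // => i; rewrite mul0mx.
- by rewrite bvecDl addmx_sub.
- by rewrite bvecZl scalemx_sub.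
Qed.

Lemma spanmx_le N (W : 'M[K]_(N, m)) :
  (forall x y, (bvec Q x y <= W)%MS) -> (\rank (spanmx Q) <= \rank W)%N.
Proof.
move=> QW; rewrite -mxrank_tr; apply: mxrankS; apply/row_subP => c.
rewrite (_ : row c _ = bvec Q (delta_mx 0 (enum_val c).1) (delta_mx 0 (enum_val c).2)) //.
by apply/rowP => i; rewrite -netf_delta netf_delta_entry !mxE.
Qed.

Definition mx4 (w0 w1 w2 w3 : 'rV[K]_m) : 'M[K]_(4, m) :=
  \matrix_(i < 4) nth 0 [:: w0; w1; w2; w3] i.

Definition row4 (c0 c1 c2 c3 : K) : 'rV[K]_4 := \row_(i < 4) nth 0 [:: c0; c1; c2; c3] i.

Lemma mul_row4 c0 c1 c2 c3 w0 w1 w2 w3 : row4 c0 c1 c2 c3 *m mx4 w0 w1 w2 w3 =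
  c0 *: w0 + c1 *: w1 + c2 *: w2 + c3 *: w3.
Proof.
by rewrite mulmx_sum_row !big_ord_recl big_ord0 !rowK !mxE /= addr0 !addrA.
Qed.

(** If the values of beta on a basis of the source are combinations of the four rows
    of W, these rows are independent as soon as the values span more than a space of
    dimension 3; they can then serve as the first vectors of a basis of the target. *)
Lemma coordinates_of_table (T : 'M[K]_n) (W : 'M[K]_(4, m)) (C : 'I_n -> 'I_n -> 'rV[K]_4) :
  T \in unitmx -> ~ (\rank (spanmx Q) <= 3)%N ->
  (forall a b, bvec Q (row a T) (row b T) = C a b *m W) ->
  (4 <= m)%N /\ row_free W /\
  equivalent_to (fun Ht => exists A', Ht = qmap A' /\
   (forall i : 'I_m, (4 <= i)%N -> polar A' i = 0) /\
   (forall (hm : (4 <= m)%N) i, polar A' (widen_ord hm i) = \matrix_(a, b) C a b 0 i)).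
Proof.
move=> Tu nsp TC.
have Wf : row_free W.
  rewrite /row_free eqn_leq rank_leq_row /= ltnNge; apply/negP => rW; apply: nsp.
  apply: leq_trans rW; apply: spanmx_le; apply: bvec_span Tu _ => a b.
  by rewrite TC submxMl.
have m4 : (4 <= m)%N by rewrite -(eqP Wf) rank_leq_col.
split=> //; split=> //; have [G Gu WG] := row_free_normal Wf.
exists G^T, T^T; split; rewrite ?unitmx_tr //.
have [A' [EA' pA']] := qmap_transform A G T; exists A'; split=> //.
have pE i a b : polar A' i a b = (C a b *m pid_mx 4 : 'rV_m) 0 i.
  by rewrite pA' TC -mulmxA WG.
split=> [i i4|hm i]; apply/matrixP => a b; rewrite pE [RHS]mxE.
  rewrite mxE big1 // => j _; rewrite mxE ltn_ord andbT.
  by case: eqP => [E|]; rewrite ?mulr0 //; move: (ltn_ord j); rewrite E ltnNge i4.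
rewrite mxE (bigD1 i) //= big1 => [|j /negPf ji]; rewrite !mxE /=.
  by rewrite eqxx ltn_ord mulr1 addr0.
by rewrite (inj_eq val_inj) ji mulr0.
Qed.

Lemma row_free_row_neq0 N (W : 'M[K]_(N, m)) i : row_free W -> row i W != 0.
Proof.
move=> Wf; rewrite rowE mulmx_free_eq0 //; apply/eqP => /rowP/(_ i).
by rewrite !mxE !eqxx => /eqP; rewrite oner_eq0.
Qed.

(** Indicator of the unordered pair {p, q}: the polar form of x_p x_q for p and q
    distinct, and of x_p^2 / 2 for p = q. *)
Definition pair_ind (p q a b : nat) : K :=
  (((a == p) && (b == q)) || ((a == q) && (b == p)))%:R.

(** The value 0 beyond the last row allows the first two or three rows to be named
    before n is known to be large enough. *)
Definition basis_row (T : 'M[K]_n) (j : nat) : 'rV[K]_n :=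
  if insub j is Some i then row (i : 'I_n) T else 0.

Lemma basis_rowE T (i : 'I_n) : basis_row T i = row i T.
Proof. by rewrite /basis_row valK. Qed.

Lemma basis_row0 T j : (n <= j)%N -> basis_row T j = 0.
Proof. by move=> nj; rewrite /basis_row insubF // ltnNge nj. Qed.

Lemma pencil_basis k (w : 'rV[K]_m) : w != 0 ->
  (\rank (stackmx (wedge Q w)) <= k)%N -> exists2 T : 'M[K]_n, T \in unitmx &
    forall a b, (k <= a)%N || (k <= b)%N ->
      exists c, bvec Q (basis_row T a) (basis_row T b) = c *: w.
Proof.
move=> w0 rk; have [T Tu T0] := rank_unit_rows_eq0 rk; exists T => //.
have [p wp] : exists p, w 0 p != 0.
  apply: NNPP => nx; case/negP: w0; apply/eqP/rowP => p; rewrite mxE.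
  by apply/eqP; apply: contraT => ne; case: nx; exists p.
have main (a : nat) y : (k <= a)%N -> exists c, bvec Q (basis_row T a) y = c *: w.
  move=> ka; have [na|an] := leqP n a.
    exists 0; rewrite basis_row0 // scale0r bvec0l // => i; exact: mul0mx.
  rewrite -[a]/(nat_of_ord (Ordinal an)) basis_rowE; set i := Ordinal an.
  exists ((row i T *m Q p *m y^T) 0 0 / w 0 p); apply/rowP => q.
  have /stackmxP/(_ (p, q)) := T0 i ka; rewrite /wedge /= mulmxBr -!scalemxAr.
  move=> /(congr1 (mulmx^~ y^T)); rewrite mulmxBl -!scalemxAl mul0mx => /matrixP/(_ 0 0).
  rewrite bvecE [RHS]mxE; set u := _ *m _; set v := row i T *m Q p *m _.
  rewrite !mxE => /eqP; rewrite subr_eq0 => /eqP E.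
  by apply: (mulfI wp); rewrite E; field.
move=> a b /orP[|kb]; first exact: main.
by rewrite bvecC; apply: main.
Qed.

Lemma pair_ind_mx hn (hk : (hn <= n)%N) (p q : 'I_hn) :
  \matrix_(a < n, b < n) pair_ind p q a b =
  let D := delta_mx (widen_ord hk p) (widen_ord hk q) in if p == q then D else D + D^T.
Proof.
apply/matrixP => a b; rewrite mxE /pair_ind /=.
case: (p =P q) => [->|/eqP pq]; first by rewrite mxE orbb.
rewrite !mxE -!val_eqE /=; have := pq; rewrite -val_eqE /= => /negPf pq'.
have [->|ap] := eqVneq (a : nat) p; first by rewrite pq' andbF orbF addr0.
by rewrite /= add0r andbC.
Qed.

Lemma qform_pair_ind hn (hk : (hn <= n)%N) (p q : 'I_hn) :
  qform (\matrix_(a < n, b < n) pair_ind p q a b) =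
  if p == q then var K hk p * var K hk q else 2%:R *: (var K hk p * var K hk q).
Proof.
rewrite (pair_ind_mx hk); case: ifP => _; first by rewrite qform_delta.
by rewrite -qformD qform_tr qform_delta -mulr2n scaler_nat.
Qed.

Lemma qform_of_pair hn (hk : (hn <= n)%N) (p q : 'I_hn) (M : 'M[K]_n) :
  2%:R != 0 :> K -> M + M^T = \matrix_(a < n, b < n) pair_ind p q a b ->
  qform M = (if p == q then 2%:R^-1 else 1) *: (var K hk p * var K hk q).
Proof.
move=> two0 E; rewrite (euler_qform M two0) E qform_pair_ind.
by case: ifP => // _; rewrite scalerA mulVf.
Qed.

Lemma first_componentsE (hm : (4 <= m)%N) (B : 'I_m -> 'M[K]_n) i j :
  first_components hm (qmap B) i j = qform (B (widen_ord hm i)).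
Proof. by rewrite !mxE. Qed.

Lemma pencil_form2 (w : 'rV[K]_m) : 2%:R != 0 :> K -> ~ (\rank (spanmx Q) <= 3)%N ->
  w != 0 -> (\rank (stackmx (wedge Q w)) <= 2)%N -> equivalent_to (@form2 K m n).
Proof.
move=> two0 nsp w0 rk; have [T Tu HT] := pencil_basis w0 rk.
pose t := basis_row T.
have HC (ab : 'I_n * 'I_n) : exists c, bvec Q (row ab.1 T) (row ab.2 T) =
    row4 c (pair_ind 0 0 ab.1 ab.2) (pair_ind 0 1 ab.1 ab.2) (pair_ind 1 1 ab.1 ab.2)
    *m mx4 w (bvec Q (t 0%N) (t 0%N)) (bvec Q (t 0%N) (t 1%N)) (bvec Q (t 1%N) (t 1%N)).
  rewrite -!basis_rowE; case: ab => [[a an] [b bn]] /=.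
  have [ab2|] := boolP ((2 <= a)%N || (2 <= b)%N).
    have [c Ec] := HT _ _ ab2; exists c; rewrite mul_row4 Ec.
    by move: a an b bn ab2 {Ec} => [|[|a]] an [|[|b]] bn //= _; rewrite /pair_ind /= !scale0r !addr0.
  move=> ab2; exists 0; rewrite mul_row4; move: a an b bn ab2 => [|[|a]] an [|[|b]] bn //= _;
    rewrite /pair_ind /= ?scale0r ?scale1r ?addr0 ?add0r //.
  by rewrite bvecC.
have [c Hc] := fin_all_exists HC.
have [m4 [Wf [S [T' [Su Tu' [A' [EA' [hi lo]]]]]]]] := coordinates_of_table
  (C := fun a b => row4 (c (a, b)) (pair_ind 0 0 a b) (pair_ind 0 1 a b) (pair_ind 1 1 a b))
  Tu nsp (fun a b => Hc (a, b)).
have n2 : (2 <= n)%N.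
  rewrite leqNgt; apply/negP => n2; have /negP := row_free_row_neq0 ord_max Wf; apply.
  rewrite rowK /= /t (basis_row0 T (j := 1%N)) // bvec0l // => i; exact: mul0mx.
exists S, T'; split=> //; rewrite EA'; split.
  by apply: contra two0 => ch; rewrite (pcharf0 ch).
exists m4, n2; split.
  by move=> i i4; apply: jacobian_row0; apply: hi.
have pol i : A' (widen_ord m4 i) + (A' (widen_ord m4 i))^T = _ := lo m4 i.
have v0 : (inord 0 : 'I_2) = 0%N :> nat by rewrite inordK.
have v1 : (inord 1 : 'I_2) = 1%N :> nat by rewrite inordK.
apply/colP => i; rewrite first_componentsE [RHS]mxE.
have comp (p q : 'I_2) : (forall a b, row4 (c (a, b)) (pair_ind 0 0 a b) (pair_ind 0 1 a b)
      (pair_ind 1 1 a b) 0 i = pair_ind p q a b) ->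
    qform (A' (widen_ord m4 i)) =
    (if p == q then 2%:R^-1 else 1) *: (var K n2 p * var K n2 q).
  move=> E; apply: qform_of_pair => //; rewrite pol.
  by apply/matrixP => a b; rewrite [LHS]mxE [RHS]mxE E.
case: i comp => -[|[|[|[|//]]]] i4 comp; rewrite (tnth_nth 0) /=.
- by rewrite first_componentsE; congr (qform (A' _)); apply: val_inj.
- by rewrite (comp (inord 0) (inord 0)) ?eqxx // => a b; rewrite !mxE v0.
- rewrite (comp (inord 0) (inord 1)); last by move=> a b; rewrite !mxE v0 v1.
  by rewrite -val_eqE /= v0 v1 scale1r.
- by rewrite (comp (inord 1) (inord 1)) ?eqxx // => a b; rewrite !mxE v1.
Qed.

Lemma pencil_form3 (w : 'rV[K]_m) : 2%:R = 0 :> K -> ~ (\rank (spanmx Q) <= 3)%N ->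
  w != 0 -> (\rank (stackmx (wedge Q w)) <= 3)%N -> equivalent_to (@form3 K m n).
Proof.
move=> two0 nsp w0 rk; have [T Tu HT] := pencil_basis w0 rk.
have alt x : bvec Q x x = 0.
  apply/rowP => i; rewrite bvecE [RHS]mxE /Q /polar mulmxDr mulmxDl.
  have E : (x *m (A i)^T *m x^T) 0 0 = (x *m A i *m x^T) 0 0.
    transitivity ((x *m A i *m x^T)^T 0 0); last by rewrite mxE.
    by rewrite !trmx_mul trmxK mulmxA.
  by rewrite [LHS]mxE E -mulr2n -mulr_natl two0 mul0r.
pose t := basis_row T.
have HC (ab : 'I_n * 'I_n) : exists c, bvec Q (row ab.1 T) (row ab.2 T) =
    row4 c (pair_ind 0 1 ab.1 ab.2) (pair_ind 0 2 ab.1 ab.2) (pair_ind 1 2 ab.1 ab.2)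
    *m mx4 w (bvec Q (t 0%N) (t 1%N)) (bvec Q (t 0%N) (t 2%N)) (bvec Q (t 1%N) (t 2%N)).
  rewrite -!basis_rowE; case: ab => [[a an] [b bn]] /=.
  have [ab3|] := boolP ((3 <= a)%N || (3 <= b)%N).
    have [c Ec] := HT _ _ ab3; exists c; rewrite mul_row4 Ec.
    by move: a an b bn ab3 {Ec} => [|[|[|a]]] an [|[|[|b]]] bn //= _; rewrite /pair_ind /= !scale0r !addr0.
  move=> ab3; exists 0; rewrite mul_row4; move: a an b bn ab3 => [|[|[|a]]] an [|[|[|b]]] bn //= _;
    rewrite /pair_ind /= ?scale0r ?scale1r ?addr0 ?add0r ?alt //; by rewrite bvecC.
have [c Hc] := fin_all_exists HC.
have [m4 [Wf [S [T' [Su Tu' [A' [EA' [hi lo]]]]]]]] := coordinates_of_table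
  (C := fun a b => row4 (c (a, b)) (pair_ind 0 1 a b) (pair_ind 0 2 a b) (pair_ind 1 2 a b))
  Tu nsp (fun a b => Hc (a, b)).
have n3 : (3 <= n)%N.
  rewrite leqNgt; apply/negP => n3; have /negP := row_free_row_neq0 ord_max Wf; apply.
  rewrite rowK /= /t (basis_row0 T (j := 2%N)) // bvecC bvec0l // => i; exact: mul0mx.
exists S, T'; split=> //; rewrite EA'; split.
  by rewrite inE /= two0 eqxx.
exists m4, n3; split.
  by move=> i i4; apply: jacobian_row0; apply: hi.
have v0 : (inord 0 : 'I_3) = 0%N :> nat by rewrite inordK.
have v1 : (inord 1 : 'I_3) = 1%N :> nat by rewrite inordK.
have v2 : (inord 2 : 'I_3) = 2%N :> nat by rewrite inordK.
apply/matrixP => i j; rewrite [LHS]mxE [RHS]mxE first_componentsE [in RHS]mxE.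
have comp (p q : 'I_3) : p != q -> (forall a b, row4 (c (a, b)) (pair_ind 0 1 a b)
     (pair_ind 0 2 a b) (pair_ind 1 2 a b) 0 i = pair_ind p q a b) ->
    (qform (A' (widen_ord m4 i)))^`M(j) = (var K n3 p * var K n3 q)^`M(j).
  move=> pq E; rewrite -qform_delta !qform_deriv; apply: eq_bigr => k _.
  have -> : A' (widen_ord m4 i) + (A' (widen_ord m4 i))^T = _ := lo m4 i.
  congr (_ *: _); have := pair_ind_mx n3 p q; rewrite (negPf pq) => /= <-.
  by rewrite [LHS]mxE [RHS]mxE E.
case: i comp => -[|[|[|[|//]]]] i4 comp; rewrite (tnth_nth 0) /=.
- by rewrite first_componentsE; congr ((qform (A' _))^`M(j)); apply: val_inj.
- apply: comp; first by rewrite -val_eqE /= v0 v1.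
  by move=> a b; rewrite !mxE v0 v1.
- apply: comp; first by rewrite -val_eqE /= v0 v2.
  by move=> a b; rewrite !mxE v0 v2.
- apply: comp; first by rewrite -val_eqE /= v1 v2.
  by move=> a b; rewrite !mxE v1 v2.
Qed.

(** Choose f with beta(f, f) nonzero and then g with beta(g, g) outside beta(f, V),
    which has dimension at most 3 because beta(f, -) kills the radical and f J. Then
    f, f J, g, g J is a basis modulo the radical, and skewness gives the table of
    beta. *)
Lemma twisted_form5 (J : 'M[K]_n) (c : K) : 2%:R != 0 :> K ->
  ~ (\rank (spanmx Q) <= 3)%N -> c != 0 -> (\rank (stackmx Q) <= 4)%N ->
  (forall i, J *m Q i + Q i *m J^T = 0) -> (forall i, J *m J *m Q i = - c *: Q i) ->
  equivalent_to (@form5 K m n).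
Proof.
move=> two0 nsp c0 rk sk sq; pose b := bvec Q.
have two_eq0 (v : 'rV[K]_m) : v + v = 0 -> v = 0.
  by move=> /eqP; rewrite -mulr2n -scaler_nat scaler_eq0 (negPf two0) => /eqP.
have skb x y : b (x *m J) y = - b x (y *m J).
  apply/eqP; rewrite -addr_eq0; apply/eqP/rowP => i; rewrite mxE !bvecE [RHS]mxE.
  transitivity ((x *m (J *m Q i + Q i *m J^T) *m y^T) 0 0).
    by rewrite mulmxDr mulmxDl [RHS]mxE trmx_mul !mulmxA.
  by rewrite sk mulmx0 mul0mx mxE.
have sqb x y : b (x *m J *m J) y = - c *: b x y.
  apply/rowP => i; rewrite bvecE [RHS]mxE bvecE.
  by rewrite -!mulmxA (mulmxA J) (mulmxA _ (Q i)) sq -!scalemxAl -!scalemxAr mxE !mulmxA.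
have bJ x : b x (x *m J) = 0.
  by apply: two_eq0; rewrite {1}/b bvecC -/b skb addNr.
have bC x y : b x y = b y x by exact: bvecC.
have bJJ x y : b (x *m J) (y *m J) = c *: b x y.
  by rewrite /b bvecC -/b -[LHS]opprK -skb sqb scaleNr opprK /b bvecC.
have polarize N (W : 'M[K]_(N, m)) : (forall x, (b x x <= W)%MS) -> (\rank (spanmx Q) <= \rank W)%N.
  move=> xW; apply: spanmx_le => x y.
  have -> : bvec Q x y = 2%:R^-1 *: (b (x + y) (x + y) - b x x - b y y).
    apply: (scalerI two0); rewrite scalerA mulfV // scale1r scaler_nat.
    rewrite /b bvecDl !bvecDr (bvecC y x) mulr2n.
    move: (bvec Q x x) (bvec Q x y) (bvec Q y y) => p q r.
    by apply/rowP => i; rewrite !mxE; ring.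
  by rewrite scalemx_sub // !addmx_sub ?eqmx_opp.
have [f ff] : exists f, b f f != 0.
  apply: NNPP => nx; apply: nsp; apply: leq_trans (polarize m 0 _) _; last by rewrite mxrank0.
  move=> x; have -> : b x x = 0; last by rewrite sub0mx.
  by apply/eqP; apply: contraT => ne; case: nx; exists x.
pose M1 := \matrix_(j < n) b f (delta_mx 0 j).
have bM1 y : b f y = y *m M1.
  rewrite {1}(row_sum_delta y) mulmx_sum_row.
  have D0 : b f 0 = 0 by rewrite -(scale0r 0) /b bvecZr scale0r.
  rewrite (big_morph (b f) (bvecDr f) D0).
  by apply: eq_bigr => j _; rewrite rowK /b bvecZr.
have fJ : ~~ (f *m J <= kermx (stackmx Q))%MS.
  apply: contra ff => /sub_kermxP/stackmxP fJ0; rewrite -(inj_eq (scalerI c0)) -bJJ.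
  by rewrite /b bvec0l // scaler0.
(* the kernel of beta(f, -) contains f J besides the radical *)
have rM1 : (\rank M1 <= 3)%N.
  have lt : (kermx (stackmx Q) < kermx (stackmx Q) + f *m J)%MS.
    by rewrite /ltmx addsmxSl addsmx_sub submx_refl.
  have le : (kermx (stackmx Q) + f *m J <= kermx M1)%MS.
    rewrite addsmx_sub; apply/andP; split; apply/sub_kermxP.
      apply/row_matrixP => i; rewrite row_mul -bM1 row0 /b bvecC bvec0l //.
      by apply/stackmxP; rewrite -row_mul mulmx_ker row0.
    by rewrite -bM1 bJ.
  have := leq_trans (rank_ltmx lt) (mxrankS le); rewrite !mxrank_ker.
  by have := rank_leq_row (stackmx Q); have := rank_leq_row M1; move: rk; lia.
have [g gg] : exists g, ~~ (b g g <= M1)%MS.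
  apply: NNPP => nx; apply: nsp; apply: leq_trans rM1; apply: polarize => x.
  by apply: contraT => ne; case: nx; exists x.
have inM y : (b f y <= M1)%MS by rewrite bM1 submxMl.
pose rows := [:: f; f *m J; g; g *m J].
pose E := \matrix_(i < 4) nth 0 rows i.
have Ef : row_free (E *m stackmx Q).
  apply/inj_row_free => z; rewrite mulmxA => /stackmxP zE.
  have zb y : b (z *m E) y = 0 by rewrite /b bvec0l.
  have zEE : z *m E = z 0 0 *: f + z 0 1 *: (f *m J) + z 0 (inord 2) *: g
                    + z 0 (inord 3) *: (g *m J).
    rewrite mulmx_sum_row !big_ord_recl big_ord0 !rowK /= addr0 !addrA.
    rewrite (_ : lift ord0 ord0 = 1); last exact: val_inj.
    rewrite (_ : lift ord0 (lift ord0 ord0) = inord 2); last by apply: val_inj; rewrite /= inordK.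
    by rewrite (_ : lift _ (lift _ _) = inord 3); last by apply: val_inj; rewrite /= inordK.
  have bE y : z 0 0 *: b f y - z 0 1 *: b f (y *m J) + z 0 (inord 2) *: b g y
                    + z 0 (inord 3) *: b (g *m J) y = 0.
    by rewrite -[RHS](zb y) zEE /b !bvecDl !bvecZl -/b (skb f) scalerN.
  have kill a v : (v <= M1)%MS -> v + a *: b g g = 0 -> a = 0.
    move=> vM /eqP; rewrite addrC addr_eq0 => /eqP Ea; apply/eqP; apply: contraT => a0.
    case/negP: gg; rewrite -(scalerK a0 (b g g)) Ea.
    by rewrite scalemx_sub // eqmx_opp.
  have z2 : z 0 (inord 2) = 0.
    apply: (kill _ (z 0 0 *: b f g - z 0 1 *: b f (g *m J))).
      by rewrite addmx_sub ?eqmx_opp ?scalemx_sub.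
    by rewrite -[RHS](bE g) (bC (g *m J) g) bJ scaler0 addr0.
  have z3 : z 0 (inord 3) = 0.
    apply: (mulIf c0); rewrite mul0r.
    apply: (kill _ (z 0 0 *: b f (g *m J) - z 0 1 *: b f (g *m J *m J))).
      by rewrite addmx_sub ?eqmx_opp ?scalemx_sub.
    by rewrite -[RHS](bE (g *m J)) z2 scale0r addr0 bJJ scalerA.
  have z0 : z 0 0 = 0.
    have := bE f; rewrite z2 z3 !scale0r !addr0 bJ scaler0 subr0 => /eqP.
    by rewrite scaler_eq0 (negPf ff) orbF => /eqP.
  have z1 : z 0 1 = 0.
    have := bE (f *m J); rewrite z2 z3 z0 !scale0r !addr0 add0r.
    rewrite (bC f) sqb scalerA => /eqP.
    by rewrite oppr_eq0 scaler_eq0 (negPf ff) orbF mulf_eq0 oppr_eq0 (negPf c0) orbF => /eqP.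
  apply/rowP => -[[|[|[|[|//]]]] i4]; rewrite mxE; [rewrite -[RHS]z0|rewrite -[RHS]z1|rewrite -[RHS]z2|rewrite -[RHS]z3];
    by congr (z 0 _); apply: val_inj; rewrite /= ?inordK.
have [T Tu [T1 T2]] := adapted_basis rk Ef.
have n4 : (4 <= n)%N.
  by rewrite -(eqP Ef) (leq_trans (mxrankM_maxr _ _)) // rank_leq_row.
pose C (a b : 'I_n) := row4 (pair_ind 0 2 a b + c * pair_ind 1 3 a b)
    (pair_ind 1 2 a b - pair_ind 0 3 a b) (pair_ind 2 2 a b + c * pair_ind 3 3 a b)
    (pair_ind 0 0 a b + c * pair_ind 1 1 a b).
have TC a b' : bvec Q (row a T) (row b' T) =
    C a b' *m mx4 (b f g) (b (f *m J) g) (b g g) (b f f).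
  have rowlow (i : 'I_n) : (i < 4)%N -> row i T = nth 0 rows i.
    by move=> i4; rewrite (T1 i (Ordinal i4)) // rowK.
  have rowhigh (i : 'I_n) y : (4 <= i)%N -> b (row i T) y = 0.
    by move=> i4; rewrite /b bvec0l //; apply/stackmxP; apply: T2.
  rewrite -/b mul_row4; have [a4|a4] := leqP 4 a.
    rewrite rowhigh //; case: (nat_of_ord a) a4 => [|[|[|[|k]]]] // _.
    by rewrite /pair_ind /= !(andbF, mulr0, addr0, subr0, scale0r).
  have [b4|b4] := leqP 4 b'.
    rewrite bC rowhigh //; case: (nat_of_ord b') b4 => [|[|[|[|k]]]] // _.
    by rewrite /pair_ind /= !(andbF, mulr0, addr0, subr0, scale0r).
  rewrite !rowlow //; move: (nat_of_ord a) (nat_of_ord b') a4 b4.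
  have bJ' x : b (x *m J) x = 0 by rewrite bC.
  have gJf : b (g *m J) f = - b (f *m J) g by rewrite skb bC.
  move=> [|[|[|[|//]]]] [|[|[|[|//]]]] _ _; rewrite /pair_ind /=;
    rewrite ?(mulr0, mulr1, oppr0, addr0, add0r, subr0, sub0r, scale0r, scale1r, scaleNr);
    rewrite ?bJJ ?bJ ?bJ' ?gJf ?(bC g f) //.
  by rewrite skb opprK.
have [m4 [Wf [S [T' [Su Tu' [A' [EA' [hi lo]]]]]]]] := coordinates_of_table Tu nsp TC.
exists S, T'; split=> //; rewrite EA'; split.
  by apply: contra two0 => ch; rewrite (pcharf0 ch).
exists m4, n4, c; split=> //; split.
  by move=> i i4; apply: jacobian_row0; apply: hi.
have v0 : (inord 0 : 'I_4) = 0%N :> nat by rewrite inordK.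
have v1 : (inord 1 : 'I_4) = 1%N :> nat by rewrite inordK.
have v2 : (inord 2 : 'I_4) = 2%N :> nat by rewrite inordK.
have v3 : (inord 3 : 'I_4) = 3%N :> nat by rewrite inordK.
apply/colP => i; rewrite first_componentsE [RHS]mxE.
have comp (p q p' q' : 'I_4) d : (forall a b, C a b 0 i = pair_ind p q a b + d * pair_ind p' q' a b) ->
    qform (A' (widen_ord m4 i)) =
      (if p == q then 2%:R^-1 else 1) *: (var K n4 p * var K n4 q)
    + (d * (if p' == q' then 2%:R^-1 else 1)) *: (var K n4 p' * var K n4 q').
  move=> EC; rewrite (euler_qform _ two0).
  have -> : A' (widen_ord m4 i) + (A' (widen_ord m4 i))^T = _ := lo m4 i.
  have -> : \matrix_(a, b) C a b 0 i = \matrix_(a < n, b < n) pair_ind p q a b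
     + d *: \matrix_(a < n, b < n) pair_ind p' q' a b.
    by apply/matrixP => a b'; rewrite mxE EC !mxE.
  rewrite -qformD qformZ !qform_pair_ind scalerDr; congr (_ + _).
    by case: ifP => // _; rewrite scalerA mulVf.
  case: ifP => // _; first by rewrite !scalerA mulrC.
  by rewrite !scalerA; congr (_ *: _); field.
case: i comp => -[|[|[|[|//]]]] i4 comp; rewrite (tnth_nth 0) /=.
- rewrite (comp (inord 0) (inord 2) (inord 1) (inord 3) c).
    by rewrite -!val_eqE /= v0 v1 v2 v3 mulr1 scale1r.
  by move=> a b'; rewrite mxE v0 v1 v2 v3.
- rewrite (comp (inord 1) (inord 2) (inord 0) (inord 3) (- 1)).
    by rewrite -!val_eqE /= v0 v1 v2 v3 mulr1 scale1r scaleN1r.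
  by move=> a b'; rewrite mxE v0 v1 v2 v3 mulN1r.
- rewrite (comp (inord 2) (inord 2) (inord 3) (inord 3) c) ?eqxx //.
  by move=> a b'; rewrite mxE v2 v3.
- rewrite (comp (inord 0) (inord 0) (inord 1) (inord 1) c) ?eqxx //.
  by move=> a b'; rewrite mxE v0 v1.
Qed.
End NormalForms.

(** * The rank of the normal forms *)

Section Converse.
Variables (K : fieldType) (m n : nat).
Implicit Types (Ht : polymap K m n) (J : 'M[{mpoly K[n]}]_(m, n)).

Lemma rank_first_cols (F : fieldType) p q k (M : 'M[F]_(p, q)) :
  only_first_cols k M -> M = M *m (pid_mx k : 'M_(q, k)) *m (pid_mx k : 'M_(k, q)).
Proof.
move=> M0; rewrite -mulmxA pid_mx_id //.
apply/matrixP => i j; rewrite mxE (bigD1 j) //= big1 => [|l /negPf lj].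
  rewrite !mxE eqxx /= addr0; case: ltnP => [|kj]; first by rewrite mulr1.
  by have /colP/(_ i) := M0 j kj; rewrite !mxE => ->; rewrite mul0r.
by rewrite !mxE (val_eqE l j) lj mulr0.
Qed.

Lemma rank_le_first_cols (F : fieldType) p q k (M : 'M[F]_(p, q)) :
  only_first_cols k M -> (\rank M <= k)%N.
Proof. by move=> /rank_first_cols ->; apply: mulmx_max_rank. Qed.

Lemma rk_first_cols k J : only_first_cols k J -> (rk J <= k)%N.
Proof.
move=> J0; apply: rank_le_first_cols => j kj.
by rewrite -map_col J0 // map_mx0.
Qed.

Lemma rk_first_rows k J : only_first_rows k J -> (rk J <= k)%N.
Proof.
move=> J0; rewrite /rk -mxrank_tr; apply: rank_le_first_cols => i ki.
by rewrite -tr_row -map_row J0 // map_mx0 trmx0.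
Qed.

Lemma rk_syzygy p q (hm : (4 <= p)%N) (J : 'M[{mpoly K[n]}]_(p, q))
    (z : 'rV[{mpoly K[n]}]_4) i : only_first_rows 4 J -> z 0 i != 0 -> z *m rowsub (widen_ord hm) J = 0 ->
  (rk J <= 3)%N.
Proof.
move=> J0 zi zJ; pose R := map_mx (@tofrac {mpoly K[n]}) (rowsub (widen_ord hm) J).
have JR : map_mx (@tofrac _) J = (pid_mx 4 : 'M_(p, 4)) *m R.
  apply/matrixP => a b; rewrite mxE [RHS]mxE; have [a4|a4] := leqP 4 a.
    have /rowP/(_ b) := J0 a a4; rewrite !mxE => ->; rewrite rmorph0 big1 // => l _.
    by rewrite !mxE ltnNge a4 andbF mul0r.
  rewrite (bigD1 (Ordinal a4)) //= big1 => [|l /negPf la].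
    rewrite !mxE eqxx a4 mul1r addr0; congr (tofrac (J _ b)); exact: val_inj.
  by rewrite mxE eq_sym -val_eqE /= in la *; rewrite la mul0r.
rewrite /rk JR; apply: leq_trans (mxrankM_maxr _ _) _.
rewrite -ltnS ltn_neqAle rank_leq_row andbT; apply: contra zi => Rf.
have : map_mx (@tofrac _) z *m R == 0 by rewrite -map_mxM zJ map_mx0.
rewrite mulmx_free_eq0 // => /eqP/rowP/(_ i); rewrite !mxE => /eqP.
by rewrite tofrac_eq0.
Qed.

Lemma jacobian_first_components (hm : (4 <= m)%N) Ht :
  rowsub (widen_ord hm) (jacobian Ht) = jacobian (first_components hm Ht).
Proof. by apply/matrixP => i j; rewrite !mxE. Qed.

Lemma var_neq0 k (hk : (k <= n)%N) i : var K hk i != 0.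
Proof.
apply/eqP => /(congr1 (meval (fun=> 1))); rewrite mevalXU meval0 => /eqP.
by rewrite oner_eq0.
Qed.

Lemma syzygy_polymap4 (hm : (4 <= m)%N) Ht a b c d (z0 z1 z2 z3 : {mpoly K[n]}) i :
  only_first_rows 4 (jacobian Ht) ->
  jacobian (first_components hm Ht) = jacobian (polymap4 a b c d) ->
  nth 0 [:: z0; z1; z2; z3] (i : 'I_4) != 0 ->
  (forall j, z0 * a^`M(j) + z1 * b^`M(j) + z2 * c^`M(j) + z3 * d^`M(j) = 0) ->
  (rk (jacobian Ht) <= 3)%N.
Proof.
move=> J0 EJ zi syz.
apply: (@rk_syzygy _ _ hm _ (\row_(i < 4) nth 0 [:: z0; z1; z2; z3] i) i) => //.
  by rewrite mxE.
rewrite jacobian_first_components EJ; apply/rowP => j; rewrite [RHS]mxE -[RHS](syz j).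
rewrite mxE !big_ord_recl big_ord0 !mxE !(tnth_nth 0) /= addr0 !addrA.
by [].
Qed.

(** The syzygies between the rows come from the relations H3^2 = 4 H2 H4 in [form2]
    and H1^2 + c H2^2 = 4 H3 H4 in [form5] by differentiation; in [form3] the last
    three rows form an alternating matrix of order 3, up to order of rows. *)
Theorem normal_form_rank Ht : quadratic_homogeneous Ht -> normal_form Ht ->
  (rk (jacobian Ht) <= 3)%N.
Proof.
move=> hom [|[|[|[|]]]].
- exact: rk_first_rows.
- move=> [c2 [hm [hn [J0 E]]]].
  have two0 : 2%:R != 0 :> K by move: c2; rewrite inE.
  move: E J0; set x1 := var K hn _; set x2 := var K hn (inord 1) => E J0.
  have sq (x : {mpoly K[n]}) j : (2%:R^-1 *: x ^+ 2)^`M(j) = x * x^`M(j).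
    rewrite mderivZ expr2 mderivM mulrC -mulr2n -scaler_nat scalerA mulVf //.
    by rewrite scale1r.
  apply: (@syzygy_polymap4 hm Ht _ _ _ _ 0 (x2 ^+ 2) (- (x1 * x2)) (x1 ^+ 2) (inord 1)) => //.
  + by rewrite E.
  + by rewrite inordK //= expf_neq0 ?var_neq0.
  + by move=> j; rewrite !sq mderivM; ring.
- move=> [c2 [hm [hn [J0 E]]]].
  have two0 : 2%:R = 0 :> {mpoly K[n]}.
    by rewrite -(rmorph_nat (@mpolyC n K)) (pcharf0 c2) rmorph0.
  move: E J0; set x1 := var K hn _; set x2 := var K hn (inord 1).
  set x3 := var K hn (inord 2) => E J0.
  apply: (@syzygy_polymap4 hm Ht _ _ _ _ 0 x3 x2 x1 (inord 1) J0 E).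
    by rewrite inordK //= var_neq0.
  move=> j; rewrite !mderivM.
  transitivity (2%:R * (x3 * x2 * x1^`M(j) + x3 * x1 * x2^`M(j) + x2 * x1 * x3^`M(j))).
    by ring.
  by rewrite two0 mul0r.
- move=> [[_ J0]|[c2 J0]]; first exact: rk_first_cols.
  have two0 : 2%:R = 0 :> {mpoly K[n]}.
    by rewrite -(rmorph_nat (@mpolyC n K)) (pcharf0 c2) rmorph0.
  have [A EA] := quadratic_homogeneous_qmap hom.
  have euler i : \sum_j 'X_j * jacobian Ht i j = 0.
    transitivity (qform (polar A i)).
      rewrite /qform exchange_big; apply: eq_bigr => j _; rewrite EA jacobian_qmap mulr_sumr.
      by apply: eq_bigr => k _; rewrite -scalerAr mulrC.
    by rewrite /polar -qformD qform_tr -mulr2n -mulr_natl two0 mul0r.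
  have [n3|n4] := leqP n 3; first exact: leq_trans (rank_leq_col _) n3.
  have <- : rk (jacobian Ht)^T = rk (jacobian Ht).
    by rewrite /rk -matrix.map_trmx mxrank_tr.
  apply: (@rk_syzygy _ _ n4 _ (\row_(l < 4) 'X_(widen_ord n4 l)) (inord 0)).
  + by move=> j j4; rewrite -tr_col J0 // trmx0.
  + by rewrite mxE; apply: var_neq0.
  apply/rowP => i; rewrite [RHS]mxE -[RHS](euler i) [RHS](bigID (fun j : 'I_n => (j < 4)%N)) /=.
  rewrite [X in _ = _ + X]big1 => [|j]; last first.
    by rewrite -leqNgt => j4; have /colP/(_ i) := J0 j j4; rewrite !mxE => ->; rewrite mulr0.
  rewrite addr0 (big_ord_narrow n4) mxE; apply: eq_bigr => l _.
  by rewrite !mxE.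
- move=> [c2 [hm [hn [c [c0 [J0 E]]]]]].
  have two0 : 2%:R != 0 :> K by move: c2; rewrite inE.
  move: E J0; set x1 := var K hn _; set x2 := var K hn (inord 1).
  set x3 := var K hn (inord 2); set x4 := var K hn (inord 3) => E J0.
  have sq (x : {mpoly K[n]}) j : (2%:R^-1 *: x ^+ 2)^`M(j) = x * x^`M(j).
    rewrite mderivZ expr2 mderivM mulrC -mulr2n -scaler_nat scalerA mulVf //.
    by rewrite scale1r.
  have sqc (x : {mpoly K[n]}) j : ((c / 2%:R) *: x ^+ 2)^`M(j) = c%:MP * (x * x^`M(j)).
    by rewrite -scalerA mderivZ sq mul_mpolyC.
  pose C := c%:MP : {mpoly K[n]}.
  apply: (@syzygy_polymap4 hm Ht _ _ _ _ (x1 * x3 + C * (x2 * x4))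
    (C * (x2 * x3 - x1 * x4)) (- (x1 ^+ 2 + C * x2 ^+ 2)) (- (x3 ^+ 2 + C * x4 ^+ 2))
    (inord 3)) => //.
  + by rewrite E.
  + rewrite inordK //= oppr_eq0; apply/eqP => /(congr1 (meval (fun i => (val i == 2%N)%:R))).
    rewrite mevalD mevalM !expr2 !mevalM /x3 /x4 /var !mevalXU /= !inordK // meval0 /=.
    by rewrite mulr1 !mulr0 addr0 => /eqP; rewrite oner_eq0.
  + by move=> j; rewrite !mderivD mderivN !sq !sqc mderivZ !mderivM -!mul_mpolyC -/C; ring.
Qed.
End Converse.

(** * The theorem *)

Theorem theorem3p1 (K : fieldType) (m n : nat)
    (m_gt0 : (0 < m)%N) (n_gt0 : (0 < n)%N) :
  (forall H : polymap K m n,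
     quadratic_homogeneous H ->
     rk (jacobian H) = 3%N ->
     exists (S : 'M[K]_m) (T : 'M[K]_n),
       [/\ S \in unitmx, T \in unitmx &
           normal_form (lmul_const S (comp_linear H T))])
  /\
  (forall Ht : polymap K m n,
     quadratic_homogeneous Ht ->
     normal_form Ht ->
     (rk (jacobian Ht) <= 3)%N).
Proof.
split; last exact: normal_form_rank.
move=> H /quadratic_homogeneous_qmap[A ->{H}] rk3.
suff: equivalent_to A (@normal_form K m n) by [].
have weaken P P' : (forall Ht, P Ht -> P' Ht) -> equivalent_to A P -> equivalent_to A P'.
  by move=> PP' [S [T [Su Tu Hp]]]; exists S, T; split=> //; apply: PP'.
have [sp|nsp] := classic (\rank (spanmx (polar A)) <= 3)%N.
  by apply: weaken (span_form1 sp) => Ht; left.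
have [two0|two0] := eqVneq (2%:R : K) 0.
  have c2 : 2%N \in [pchar K] by rewrite inE /= two0 eqxx.
  have [//|st|[w w0 rw]] := even_rank3 rk3 two0.
    by apply: weaken (small_stack_first_cols st) => Ht HJ; right; right; right; left; right.
  by apply: weaken (pencil_form3 two0 nsp w0 rw) => Ht; right; right; left.
have c2 : 2%N \notin [pchar K] by apply: contra two0 => ch; rewrite (pcharf0 ch).
have [//|st|[w w0 rw]|[J [c [c0 st sk sq]]]] := odd_rank3 rk3 two0.
- by apply: weaken (small_stack_first_cols st) => Ht HJ; right; right; right; left; left.
- by apply: weaken (pencil_form2 two0 nsp w0 rw) => Ht; right; left.
- by apply: weaken (twisted_form5 two0 nsp c0 st sk sq) => Ht; right; right; right; right.
Qed.
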